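(* Let $\Omega=\mathbb T^d$ and let $A=\frac12\Sigma\Sigma^\top$ be a constant, symmetric positive-definite matrix with smallest eigenvalue $\kappa>0$. Let $h>0$ be the observation resolution (kernel bandwidth), $\lambda>0$ the nudging intensity, and $T>0$ the final time. Let $(\mu_t)_{t\ge0}$ and $(\nu_t)_{t\ge0}$ be classical solutions, respectively, of the true Fokker--Planck equation $$\partial_t\mu_t=-\nabla\cdot\big(b_{\mathrm{true}}(\cdot,\mu_t)\,\mu_t\big)+\nabla\cdot(A\nabla\mu_t)$$ and of the assimilated equation $$\partial_t\nu_t=-\nabla\cdot\big(\nu_t\,b_{\mathrm{model}}(\cdot,\nu_t)\big)+\nabla\cdot(A\nabla\nu_t)+\lambda\,\nabla\cdot\big[\nu_t\nabla(K_h*r_t)\big],\qquad r_t:=K_h*\nu_t-\mu_t^{\mathrm{obs}},\quad \mu_t^{\mathrm{obs}}:=K_h*\mu_t,$$ with initial conditions satisfying $\int_\Omega(\nu_0-\mu_0)\,dx=0$. Define the error $e_t:=\nu_t-\mu_t$ and the $L^2$-error energy $V(t):=\frac12\|e_t\|_{L^2(\Omega)}^2$. Suppose the following. (C1) There are constants $B_{\mathrm{model}},L_{\mathrm{model}}>0$ such that for all $\rho\in\mathcal P_2(\Omega)$, $\|b_{\mathrm{model}}(\cdot,\rho)\|_{L^\infty(\Omega)}\le B_{\mathrm{model}}$ and $\|\nabla\cdot b_{\mathrm{model}}(\cdot,\rho)\|_{L^\infty(\Omega)}\le B_{\mathrm{model}}$, and for all $x_1,x_2\in\Omega$ and $\rho_1,\rho_2\in\mathcal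 P_2(\Omega)$, $\|b_{\mathrm{model}}(x_1,\rho_1)-b_{\mathrm{model}}(x_2,\rho_2)\|\le L_{\mathrm{model}}(\|x_1-x_2\|+W_2(\rho_1,\rho_2))$; in addition, $\|b_{\mathrm{model}}(\cdot,\mu)-b_{\mathrm{model}}(\cdot,\nu)\|_{L^2(\Omega)}\le L_\mu\|\mu-\nu\|_{L^2(\Omega)}$ for all $\mu,\nu\in\mathcal P_2(\Omega)$, with a constant $L_\mu$. (C2) The true density and the assimilated density are uniformly bounded above, $\|\mu_t\|_{L^\infty},\|\nu_t\|_{L^\infty}\le\bar\rho$, and the assimilated density is uniformly bounded below, $\nu_t(x)\ge\underline\nu>0$, for all $(x,t)\in\Omega\times[0,T]$. (C3) There is a function $\delta(h)\to0$ as $h\to0$ such that $\|\nabla e_t-\nabla(\tilde K_h*e_t)\|_{L^2(\Omega)}\le\delta(h)\|\nabla e_t\|_{L^2(\Omega)}$. Define $C_{\mathrm{adv}}:=B_{\mathrm{model}}+\bar\rho L_\mu$ and $\Delta:=\sup_{t\in[0,T]}\|b_{\mathrm{model}}(\cdot,\mu_t)-b_{\mathrm{true}}(\cdot,\mu_t)\|_{L^\infty(\Omega)}$, and let $C_P$ be the Poincaré constant of $\Omega$ for zero-mean functions. If $h$ and $\lambda$ satisfy $$\delta(h)\le\frac{\underline\nu}{2\bar\rho}\qquad\text{and}\qquad \lambda>\frac1{\underline\nu}\left(\frac{2C_{\mathrm{adv}}^2C_P}{\kappa}-\kappa\right),$$ then the $L^2$ error decays exponentially to a model-error floor: with the rate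 $$\alpha:=\frac{\kappa+\lambda\underline\nu}{C_P}-\frac{2C_{\mathrm{adv}}^2}{\kappa}>0,$$ it holds for all $t\ge0$ that $$V(t)\le e^{-\alpha t}V(0)+\frac{\bar\rho^2}{\alpha\kappa}\Delta^2 .$$ In particular, $$\limsup_{t\to\infty}\|\nu_t-\mu_t\|_{L^2(\Omega)}^2\le\frac{2\bar\rho^2}{\alpha\kappa}\Delta^2,$$ so the long-time error is controlled by a bias floor proportional to $\Delta^2$ that vanishes when the model is exact ($\Delta=0$).
   Context: $\mathbb T^d=\mathbb R^d/\mathbb Z^d$ is the flat torus. $\mathcal P_2(\Omega)$ is the set of Borel probability measures on $\Omega$ with finite second moment, $W_2$ is the 2-Wasserstein distance, and absolutely continuous measures are identified with their densities. $b_{\mathrm{true}}$ and $b_{\mathrm{model}}$, defined on $\Omega\times\mathcal P_2(\Omega)$ with values in $\mathbb R^d$, are the true and the model drifts; $\Sigma\in\mathbb R^{d\times d}$ is a constant diffusion matrix. The solutions $\mu_t$ and $\nu_t$ are probability densities on $\Omega$. $K_h$ is an even ($K_h(x)=K_h(-x)$), nonnegative smoothing kernel with bandwidth $h>0$; $*$ is convolution on $\Omega$; $\tilde K_h:=K_h*K_h$. The Poincaré constant $C_P$ is the constant for which $\|f\|_{L^2(\Omega)}^2\le C_P\|\nabla f\|_{L^2(\Omega)}^2$ for zero-mean functions $f$ on $\Omega$.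
   Formalization: The final time T may be finite or infinite: (C2), (C3), Δ and the bound on V(t) are taken over 0≤t≤T rather than all t≥0, and the limsup claim is stated for T=∞, since the bound can fail after a finite T. *)

(* Defs.v *)
From HB Require Import structures.
From mathcomp Require Import all_boot all_order all_algebra.
From mathcomp Require Import generic_quotient ring_quotient.
From mathcomp Require Import all_classical all_reals all_analysis.
From mathcomp Require Import measurable_realfun.

Set Implicit Arguments.
Unset Strict Implicit.
Unset Printing Implicit Defensive.

Import Order.TTheory GRing.Theory Num.Theory.
Import numFieldNormedType.Exports.

Local Open Scope classical_set_scope.
Local Open Scope ring_scope.

Section Torus.
Context (R : realType) (d : nat).

Definition int_vector : {pred 'cV[R]_d} :=
  [pred v | v \is a mxOver (Num.int : {pred R})].

Fact int_vector_zmod_closed : zmod_closed int_vector.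
Proof.
split=> [|u v /mxOverP uZ /mxOverP vZ]; apply/mxOverP => i j.
  by rewrite mxE rpred0.
by rewrite !mxE rpredB ?uZ ?vZ.
Qed.

HB.instance Definition _ :=
  GRing.isZmodClosed.Build _ int_vector int_vector_zmod_closed.

Definition torus : Type := Quotient.quot int_vector.
HB.instance Definition _ := GRing.Zmodule.on torus.
HB.instance Definition _ := isPointed.Build torus 0.

Definition tproj (v : 'cV[R]_d) : torus := (\pi_(Quotient.quot int_vector) v)%qT.

Definition torus_open (U : set torus) : Prop := open (tproj @^-1` U).

Fact torus_openT : torus_open setT.
Proof. by rewrite /torus_open preimage_setT; exact: openT. Qed.

Fact torus_openI (U V : set torus) :
  torus_open U -> torus_open V -> torus_open (U `&` V).
Proof. exact: openI. Qed.

Fact torus_open_bigcup (I : Type) (F : I -> set torus) :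
  (forall i, torus_open (F i)) -> torus_open (\bigcup_i F i).
Proof. by move=> oF; apply: bigcup_open => i _; exact: oF. Qed.

HB.instance Definition _ :=
  isOpenTopological.Build torus torus_openT torus_openI torus_open_bigcup.

(* Borel sigma-algebra *)
HB.instance Definition _ :=
  Measurable.copy torus (g_sigma_algebraType (@open torus)).

Lemma tproj_continuous : continuous tproj.
Proof. exact/continuousP. Qed.

End Torus.

Section Haar.
Context (R : realType).

Definition tuple_col d (t : d.-tuple (measurableTypeR R)) : 'cV[R]_d :=
  \col_i tnth t i.

Lemma measurable_preimage_tuple_col d (U : set 'cV[R]_d) :
  open U -> measurable (@tuple_col d @^-1` U).
Proof.
move=> oU.
pose box (q : {ffun 'I_d -> rat * rat}) : set (d.-tuple (measurableTypeR R)) :=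
  \bigcap_(i in [set: 'I_d])
    (@tnth _ (measurableTypeR R) ^~ i) @^-1` `](ratr (q i).1), (ratr (q i).2)[.
have mbox q : measurable (box q).
  apply: fin_bigcap_measurable => [|i _]; first exact: finite_finset.
  rewrite -[X in measurable X]setTI; exact: measurable_tnth.
rewrite (_ : _ @^-1` U = \bigcup_q (if `[< box q `<=` @tuple_col d @^-1` U >]
    then box q else set0)); last first.
  apply/seteqP; split => [t Ut|t [q _]]; last by case: asboolP => // + tq; exact.
  have [P tP PU] : nbhs (tuple_col t) U by exact: open_nbhs_nbhs.
  have ex i : exists q : rat * rat, (tnth t i \in `](ratr q.1 : R), (ratr q.2)[) /\
      forall x : R, x \in `](ratr q.1 : R), (ratr q.2)[ -> P i 0 x.
    have := tP i 0; rewrite mxE -nbhs_ballE => -[e /= e0 eP].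
    have ta : (tnth t i : R) - e < tnth t i by rewrite ltrBlDr ltrDl.
    have tb : (tnth t i : R) < tnth t i + e by rewrite ltrDl.
    have [a] := rat_in_itvoo ta; rewrite in_itv /= => /andP[ea at_].
    have [b] := rat_in_itvoo tb; rewrite in_itv /= => /andP[bt eb].
    exists (a, b); split=> /= [|x]; rewrite in_itv /=; first by rewrite at_ bt.
    move=> /andP[ax xb]; apply: eP; rewrite /ball /= ltr_distlC.
    by rewrite (lt_trans ea ax) (lt_trans xb eb).
  have /choice[q qP] := ex.
  exists [ffun i => q i] => //; case: asboolP => [_ i _|]; last first.
    case=> x xq; apply: PU => i j; rewrite ord1 mxE; apply: (qP i).2.
    by have := xq i I; rewrite /= ffunE.
  by rewrite /= ffunE; exact: (qP i).1.
apply: countable_bigcupT_measurable => [|q]; first exact: countableP.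
by case: asboolP.
Qed.

Definition tuple_torus d (t : d.-tuple (measurableTypeR R)) : torus R d :=
  tproj (tuple_col t).

Lemma measurable_tuple_torus d : measurable_fun setT (@tuple_torus d).
Proof.
apply: (@measurability _ _ _ _ _ _ (@open (torus R d))) => // _ [U oU <-].
by rewrite setTI; exact: (measurable_preimage_tuple_col oU).
Qed.

HB.instance Definition _ d :=
  isMeasurableFun.Build _ _ _ _ (@tuple_torus d) (@measurable_tuple_torus d).

Definition tuple_cons d
    (p : measurableTypeR R * d.-tuple (measurableTypeR R)) :
  d.+1.-tuple (measurableTypeR R) := [tuple of p.1 :: p.2].

Lemma measurable_tuple_cons d : measurable_fun setT (@tuple_cons d).
Proof. exact: measurable_cons. Qed.

HB.instance Definition _ d :=
  isMeasurableFun.Build _ _ _ _ (@tuple_cons d) (@measurable_tuple_cons d).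

(* Lebesgue measure on the unit cube of R^d, as a d-fold product *)
Fixpoint cube_measure (d : nat) : probability (d.-tuple (measurableTypeR R)) R :=
  match d with
  | 0 => dirac [tuple]
  | d'.+1 =>
      distribution (uniform_prob (@ltr01 R) \x cube_measure d')%E (@tuple_cons d')
  end.

(* the Lebesgue (Haar) measure dx of the torus *)
Definition haar (d : nat) : probability (torus R d) R :=
  distribution (cube_measure d) (@tuple_torus d).

End Haar.
Arguments haar {R d}.

Section Density.
Context (R : realType) (d : nat).

Record density := Density {
  density_fun :> torus R d -> R ;
  density_measurable : measurable_fun setT density_fun ;
  density_ge0 : forall x, 0 <= density_fun x ;
  density_int1 : (\int[haar]_x (density_fun x)%:E = 1)%E
}.

Definition density_prob (f : density) : set (torus R d) -> \bar R :=
  fun A => (\int[haar]_(x in A) (f x)%:E)%E.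

Variable f : density.

Let density_prob0 : density_prob f set0 = 0%E.
Proof. by rewrite /density_prob integral_set0. Qed.

Let density_prob_ge0 A : (0 <= density_prob f A)%E.
Proof. by apply: integral_ge0 => x _; rewrite lee_fin density_ge0. Qed.

Let density_prob_sigma_additive : semi_sigma_additive (density_prob f).
Proof.
move=> /= A mA tA mUA.
have mf : measurable_fun (\bigcup_n A n) (fun x => (f x)%:E).
  apply: measurable_funTS; apply: measurableT_comp; first exact: EFin_measurable.
  exact: density_measurable.
have f0 x : (\bigcup_n A n) x -> (0 <= (f x)%:E)%E by rewrite lee_fin density_ge0.
rewrite /density_prob (ge0_integral_bigcup haar mA mf f0 tA).
apply: is_cvg_ereal_nneg_natsum_cond => n _ _.
by apply: integral_ge0 => x _; rewrite lee_fin density_ge0.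
Qed.

HB.instance Definition _ := isMeasure.Build _ _ _ (density_prob f)
  density_prob0 density_prob_ge0 density_prob_sigma_additive.

Let density_probT : density_prob f setT = 1%E.
Proof. exact: density_int1. Qed.

HB.instance Definition _ :=
  @Measure_isProbability.Build _ _ R (density_prob f) density_probT.

End Density.

Section EuclideanGeometry.
Context (R : realType) (d : nat).

Definition enorm (v : 'cV[R]_d) : R := Num.sqrt (\sum_i v i 0 ^+ 2).

(* flat distance: the shortest representative in R^d of the difference *)
Definition tdist (x y : torus R d) : R :=
  inf [set enorm v | v in [set v | tproj v = x - y]].

Definition finite_second_moment (rho : probability (torus R d) R) : Prop :=
  (\int[rho]_x ((tdist x 0) ^+ 2)%:E < +oo)%E.

Definition coupling (rho1 rho2 : probability (torus R d) R)
    (pi : probability (torus R d * torus R d)%type R) : Prop :=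
  forall A : set (torus R d), measurable A ->
    pi (A `*` setT) = rho1 A /\ pi (setT `*` A) = rho2 A.

Definition W2 (rho1 rho2 : probability (torus R d) R) : \bar R :=
  sqrte (ereal_inf [set (\int[pi]_p ((tdist p.1 p.2) ^+ 2)%:E)%E |
                    pi in coupling rho1 rho2]).

End EuclideanGeometry.

Section Calculus.
Context (R : realType) (d : nat).
Implicit Types (f : torus R d -> R) (F : torus R d -> 'cV[R]_d).

(* Derivatives on the torus are taken along the projections of the coordinate
   lines of R^d, which is the same as differentiating the periodic lift. *)
Definition line f (i : 'I_d) (x : torus R d) (s : R) : R :=
  f (x + tproj (s *: delta_mx i 0)).

Definition pderiv (i : 'I_d) f (x : torus R d) : R := derive1 (line f i x) 0.

Definition grad f (x : torus R d) : 'cV[R]_d := \col_i pderiv i f x.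

Definition divergence F (x : torus R d) : R :=
  \sum_i pderiv i (fun y => F y i 0) x.

Definition C1 f : Prop :=
  [/\ continuous f,
      forall i x, derivable (line f i x) 0 1 &
      forall i, continuous (pderiv i f)].

Definition C1_field F : Prop := forall i, C1 (fun x => F x i 0).

Definition convolution (f g : torus R d -> R) (x : torus R d) : R :=
  \int[haar]_y (f (x - y) * g y).

Definition L2norm f : \bar R := Lnorm haar 2%:E (EFin \o f).
Definition Linfty_norm f : \bar R := Lnorm haar +oo%E (EFin \o f).

(* norms of vector fields are those of the pointwise Euclidean norm *)
Definition L2norm_field F : \bar R := L2norm (fun x => enorm (F x)).
Definition Linfty_norm_field F : \bar R := Linfty_norm (fun x => enorm (F x)).

(* A minimal regularity: integrability makes the convolutions meaningful. *)
Definition smoothing_kernel (k : torus R d -> R) : Prop :=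
  [/\ forall x, k (- x) = k x,
      forall x, 0 <= k x &
      haar.-integrable setT (EFin \o k)].

(* any admissible constant, in particular the optimal one *)
Definition poincare_constant (C : R) : Prop :=
  0 < C /\
  forall f, C1 f -> \int[haar]_x f x = 0 ->
    ((L2norm f) ^+ 2 <= C%:E * (L2norm_field (grad f)) ^+ 2)%E.

End Calculus.

Section LinearAlgebra.
Context (R : realType) (d : nat).

Definition positive_definite (A : 'M[R]_d) : Prop :=
  A^T = A /\ forall v : 'cV[R]_d, v != 0 -> 0 < (v^T *m A *m v) 0 0.

Definition smallest_eigenvalue (A : 'M[R]_d) (a : R) : Prop :=
  eigenvalue A a /\ forall b, eigenvalue A b -> a <= b.

End LinearAlgebra.

Section FokkerPlanck.
Context (R : realType) (d : nat).
Local Notation T := (torus R d).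
Local Notation drift := (T -> probability T R -> 'cV[R]_d).

Definition time_deriv (u : R -> T -> R) (t : R) (x : T) : R :=
  derive1 (fun s => u s x) t.

(* u is continuous on [0, +oo[ x T^d and C^{1,2} on ]0, +oo[ x T^d *)
Record C12 (u : R -> T -> R) : Prop := {
  C12_cont : {within [set p : R * T | 0 <= p.1],
    continuous (fun p : R * T => u p.1 p.2)} ;
  C12_dt : forall t x, 0 < t -> derivable (fun s => u s x) t 1 ;
  C12_dt_cont : forall p : R * T, 0 < p.1 ->
    {for p, continuous (fun p : R * T => time_deriv u p.1 p.2)} ;
  C12_dx : forall t i x, 0 < t -> derivable (line (u t) i x) 0 1 ;
  C12_dx_cont : forall i (p : R * T), 0 < p.1 ->
    {for p, continuous (fun p : R * T => pderiv i (u p.1) p.2)} ;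
  C12_dxx : forall t i j x, 0 < t ->
    derivable (line (pderiv j (u t)) i x) 0 1 ;
  C12_dxx_cont : forall i j (p : R * T), 0 < p.1 ->
    {for p, continuous (fun p : R * T => pderiv i (pderiv j (u p.1)) p.2)}
}.

(* A measure enters the drift through its density: [density_prob u] is u dx. *)
Definition transport_flux (b : drift) (u : density R d) : T -> 'cV[R]_d :=
  fun x => u x *: b x (density_prob u).

Definition diffusion_flux (A : 'M[R]_d) (u : density R d) : T -> 'cV[R]_d :=
  fun x => A *m grad u x.

Definition nudging_flux (k : T -> R) (u v : density R d) : T -> 'cV[R]_d :=
  let r x := convolution k v x - convolution k u x in
  fun x => v x *: grad (convolution k r) x.

Definition fokker_planck_solution (A : 'M[R]_d) (b : drift)
    (mu : R -> density R d) : Prop :=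
  C12 (fun t => mu t) /\
  forall t, 0 < t ->
    C1_field (transport_flux b (mu t)) /\
    forall x, time_deriv (fun t => mu t) t x =
      - divergence (transport_flux b (mu t)) x
      + divergence (diffusion_flux A (mu t)) x.

Definition assimilated_solution (A : 'M[R]_d) (b : drift) (k : T -> R)
    (lambda : R) (mu nu : R -> density R d) : Prop :=
  C12 (fun t => nu t) /\
  forall t, 0 < t ->
    [/\ C1_field (transport_flux b (nu t)),
        C1_field (nudging_flux k (mu t) (nu t)) &
        forall x, time_deriv (fun t => nu t) t x =
          - divergence (transport_flux b (nu t)) x
          + divergence (diffusion_flux A (nu t)) x
          + lambda * divergence (nudging_flux k (mu t) (nu t)) x].

End FokkerPlanck.

Section Hypotheses.
Context (R : realType) (d : nat).
Local Notation drift := (torus R d -> probability (torus R d) R -> 'cV[R]_d).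

(* The L^oo norm is an essential supremum: for a Lipschitz drift it ignores the
   null set where the divergence has no meaning. *)
Definition bounded_drift (b : drift) (B : R) : Prop :=
  forall rho, finite_second_moment rho ->
    (Linfty_norm_field (b ^~ rho) <= B%:E)%E /\
    (Linfty_norm (divergence (b ^~ rho)) <= B%:E)%E.

Definition lipschitz_drift (b : drift) (L : R) : Prop :=
  forall x1 x2 rho1 rho2,
    finite_second_moment rho1 -> finite_second_moment rho2 ->
    ((enorm (b x1 rho1 - b x2 rho2))%:E <=
      L%:E * ((tdist x1 x2)%:E + W2 rho1 rho2))%E.

(* the L^2 distance of two measures is that of their densities *)
Definition L2_lipschitz_drift (b : drift) (L : R) : Prop :=
  forall f g : density R d,
    (L2norm_field (fun x => (b x (density_prob f) - b x (density_prob g))%R) <=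
      L%:E * L2norm (fun x => (f x - g x)%R))%E.

(* time interval [0, T]; T = +oo gives all times t >= 0 *)
Definition horizon (T : \bar R) : set R := [set t | 0 <= t /\ (t%:E <= T)%E].

End Hypotheses.

(* Main.v *)
(* With [p = ||grad e||] and [q = ||e||] in L^2, testing the equation of the error
   [e = nu - mu] with [e] gives [V' = int grad e . (nu b_model(nu) - mu b_true(mu))
   - int grad e . A grad e - lambda int nu grad e . grad (Ktilde * e)].  The drift
   difference contributes at most [Cadv p q + rhobar Delta p], the diffusion
   [- kappa p^2], and the nudging, since it only sees [e] up to a smoothing error
   [delta(h) p], at most [- lambda nulow p^2 / 2].  Young and Poincare turn this
   into [V' <= - alpha V + rhobar^2 Delta^2 / kappa], and Gronwall concludes.
   Integration by parts on the torus amounts to [int d_i f = 0], obtained by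
   differentiating the translation invariant integral [int f(x + s e_i) dx] in [s]. *)
From HB Require Import structures.
Require Import Defs.
From mathcomp Require Import all_boot all_order all_algebra.
From mathcomp Require Import generic_quotient ring_quotient.
From mathcomp Require Import all_classical all_reals all_analysis.
From mathcomp Require Import measurable_realfun ess_sup_inf ring lra.
Import Order.TTheory GRing.Theory Num.Theory.
Import numFieldNormedType.Exports.
Set Implicit Arguments.
Unset Strict Implicit.
Unset Printing Implicit Defensive.
Local Open Scope classical_set_scope.
Local Open Scope ring_scope.

(** * The flat torus *)

(** Three things shape the argument. The kernel is merely integrable, so the smoothed error has no
    regularity of its own: the continuity of its gradient is read off the nudging flux, which is
    [C1] in a classical solution, after division by the density, which is bounded below. For the
    same reason integration by parts is applied once to the total flux, and only afterwards is the
    flux split into its terms. The sup norms are essential suprema, so the integrands are compared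
    almost everywhere. The Haar measure is the image of a product measure on the cube, so its
    invariance is proved by induction on the dimension. The constants of [alpha] arise as follows.
    Of the dissipation [(kappa + lambda nulow) p^2], half of [kappa] pays for two Young inequalities
    of weight [kappa / 4], and half of [lambda nulow] pays for the smoothing error. Poincare turns
    the other half into [(kappa + lambda nulow) / (2 CP) q^2], while Young leaves
    [Cadv^2 / kappa q^2]. Since [q^2 = 2 V], the rate is their difference, doubled. *)

Lemma continuous_sumr (R : realType) (X : topologicalType) (I : Type) (r : seq I)
    (h : I -> X -> R) :
  (forall j, continuous (h j)) -> continuous (fun x => \sum_(j <- r) h j x).
Proof.
move=> ch; elim: r => [|j r IH].
  by under eq_fun do rewrite big_nil; exact: cst_continuous.
under eq_fun do rewrite big_cons.
by move=> x; apply: continuousD; [exact: ch|exact: IH].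
Qed.

Section TorusBasics.
Context {R : realType} {d : nat}.
Implicit Types (v w : 'cV[R]_d) (x y a : torus R d).

Lemma tprojB : {morph @tproj R d : v w / v - w}.
Proof. by move=> v w; rewrite /tproj raddfB. Qed.

Lemma tprojD : {morph @tproj R d : v w / v + w}.
Proof. by move=> v w; rewrite /tproj raddfD. Qed.

Lemma tproj0 : tproj (0 : 'cV[R]_d) = 0.
Proof. by rewrite /tproj raddf0. Qed.

Lemma tproj_surj x : exists v, tproj v = x.
Proof. by exists (repr x); rewrite /tproj reprK. Qed.

Lemma tproj_eq0 v : v \in @int_vector R d -> tproj v = 0.
Proof.
move=> vZ; rewrite -tproj0; apply/eqP; rewrite /tproj.
by rewrite -Quotient.idealrBE subr0.
Qed.

Lemma continuous_torus (Y : topologicalType) (f : torus R d -> Y) :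
  continuous (f \o @tproj R d) -> continuous f.
Proof.
by move=> /continuousP cf; apply/continuousP => U oU; exact: cf.
Qed.

Lemma continuous_tshift a : continuous (fun x : torus R d => x + a).
Proof.
apply: continuous_torus; have [w <-] := tproj_surj a.
have -> : (fun x => x + tproj w) \o @tproj R d = @tproj R d \o (fun v => v + w).
  by apply/funext => v /=; rewrite tprojD.
move=> v; apply: continuous_comp; last exact: tproj_continuous.
by apply: (@continuousD _ _ _ id (cst w)); [exact: cvg_id|exact: cst_continuous].
Qed.

(** Subtract the coordinatewise floors. A representative in the closed cube is enough, both for
    compactness and for bounding the flat distance. *)
Lemma tproj_frac x :
  exists2 v : 'cV[R]_d, tproj v = x & forall i, 0 <= v i 0 <= 1.
Proof.
have [w <-] := tproj_surj x.
exists (w - \col_i (Num.floor (w i 0))%:~R) => [|i].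
  rewrite tprojB (@tproj_eq0 (\col_i _)) ?subr0//.
  by apply/mxOverP => i j; rewrite mxE intr_int.
by rewrite !mxE subr_ge0 Num.Theory.floor_le lerBlDr addrC ltW// -intrD1 floorD1_gt.
Qed.

(** The closed unit cube projects onto the torus. The cube is taken among row vectors, where
    [rV_compact] applies, hence the transpose. *)
Lemma compact_torus : compact [set: torus R d].
Proof.
pose B := [set v : 'rV[R]_d | forall i, `[0 : R, 1]%classic (v ord0 i)].
have cB : compact B.
  by apply: (@rV_compact _ _ (fun=> `[0 : R, 1]%classic)) => i; exact: segment_compact.
have -> : [set: torus R d] = (@tproj R d \o @trmx R 1 d) @` B.
  apply/seteqP; split=> // x _; have [v <- v01] := tproj_frac x.
  by exists v^T => [i|]; rewrite /= ?trmxK// mxE in_itv/=.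
apply: continuous_compact cB; apply: continuous_subspaceT => v.
apply: continuous_comp; last exact: tproj_continuous.
move=> P [/= e e0 eP]; exists (fun i j => e j i) => /= [i j|w vw].
  by have := e0 j i; rewrite mxE.
by apply: eP => /= i j; rewrite mxE; exact: vw.
Qed.

Lemma continuous_measurable_torus (f : torus R d -> R) :
  continuous f -> measurable_fun setT f.
Proof.
move=> /continuousP cf; apply: (measurability _ (RGenOpens.measurableE R)).
move=> _ [_ [a [b ->] <-]]; rewrite setTI.
by apply: sub_sigma_algebra; apply: cf; exact: interval_open.
Qed.

Lemma measurable_tshift a : measurable_fun setT (fun x : torus R d => x + a).
Proof.
apply: (@measurability _ _ _ _ _ _ (@open (torus R d))) => // _ [U oU <-].
rewrite setTI; apply: sub_sigma_algebra.
by have /continuousP := @continuous_tshift a; exact.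
Qed.

Lemma torus_bounded (f : torus R d -> R) :
  continuous f -> exists M, forall x, `|f x| <= M.
Proof.
move=> cf.
have [||c _ fc] := @compact_EVT_max _ _ (fun x => `|f x|) _ _ compact_torus.
- by exists (0 : torus R d).
- apply: continuous_subspaceT => x.
  by apply: continuous_comp; [exact: cf|exact: norm_continuous].
- by exists `|f c| => x; apply: fc; rewrite inE.
Qed.

Lemma continuous_integrable_torus (f : torus R d -> R) :
  continuous f -> haar.-integrable setT (EFin \o f).
Proof.
move=> cf; apply: measurable_bounded_integrable => //.
- by rewrite [ltLHS](@probability_setT _ _ _ haar) ltry.
- exact: continuous_measurable_torus.
- have [M fM] := torus_bounded cf.
  exists M; split=> [|r Mr x _ /=]; first exact: num_real.
  exact: le_trans (fM x) (ltW Mr).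
Qed.

End TorusBasics.

(** * Translation invariance of the Haar measure *)

Section LebesgueShift.
Context {R : realType}.
Local Notation leb := (@lebesgue_measure R).

Lemma measurable_shift (s : R) :
  measurable_fun setT ((fun x => x + s) : measurableTypeR R -> measurableTypeR R).
Proof. by apply: measurable_funD => //; exact: measurable_cst. Qed.

Lemma shift_preimage_itvco (a b s : R) :
  (fun x => x + s) @^-1` `[a + s, b + s[ = `[a, b[%classic.
Proof. by apply/seteqP; split=> x /=; rewrite !in_itv/= lerD2r ltrD2r. Qed.

(** Lebesgue measure is determined by its values on half-open intervals, and a translate of such an
    interval has the same length. *)
Lemma lebesgue_measure_shift (s : R) (A : set R) : measurable A ->
  pushforward leb ((fun x => x + s) : measurableTypeR R -> measurableTypeR R) A =
  leb A.
Proof.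
move=> mA; apply/esym.
apply: lebesgue_measure_unique => [|ms _ [[a b]] _ <-|//].
  exact: measurable_shift.
rewrite /= /pushforward/=.
rewrite (_ : _ @^-1` _ = `]a - s, b - s]%classic); last first.
  by apply/seteqP; split=> x /=; rewrite !in_itv/= ltrBlDr lerBrDr.
rewrite !lebesgue_measure_itv/= !lte_fin ltrD2r -!EFinB.
by congr (if _ then _%:E else _); ring.
Qed.

Lemma ge0_integral_shift_itvco (f : R -> \bar R) (a b s : R) :
  measurable_fun [set: measurableTypeR R] f -> (forall x, 0 <= f x)%E ->
  (\int[leb]_(x in `[a, b[) f (x + s)%R =
   \int[leb]_(x in `[(a + s)%R, (b + s)%R[) f x)%E.
Proof.
move=> mf f0; rewrite -(shift_preimage_itvco a b s).
rewrite -(ge0_integral_pushforward (measurable_shift s) leb (f := f))//.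
  apply: eq_measure_integral => [|ms A mA _]; first exact: measurable_shift.
  exact: lebesgue_measure_shift.
exact: measurable_funS mf.
Qed.

(** Periodicity replaces [s] by its fractional part [r]. The shifted period [[r, 1 + r[] is cut at
    1, and the piece [[1, 1 + r[] is moved back onto [[0, r[]. Half-open intervals make the cuts
    exact partitions. *)
Lemma ge0_integral_periodic_shift (f : R -> \bar R) (s : R) :
  measurable_fun [set: measurableTypeR R] f -> (forall x, 0 <= f x)%E ->
  (forall x y : R, y - x \is a Num.int -> f y = f x) ->
  (\int[leb]_(x in `[0%R, 1%R]) f (x + s)%R = \int[leb]_(x in `[0%R, 1%R]) f x)%E.
Proof.
move=> mf f0 fper.
have [r [r0 r1 fr]] : exists r : R, [/\ 0 <= r, r < 1 &
    forall x : R, f (x + s) = f (x + r)].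
  exists (s - (Num.floor s)%:~R); split.
  - by rewrite subr_ge0 Num.Theory.floor_le.
  - by have /andP[_] := floor_itv s; rewrite ltrBlDl intrD1 addrC.
  - move=> x; apply: fper; rewrite (_ : _ - _ = (Num.floor s)%:~R) ?intr_int//.
    by ring.
under eq_integral do rewrite fr.
have mS A : measurable_fun A f by exact: measurable_funS mf.
have mSr : measurable_fun setT (fun x : measurableTypeR R => f (x + r)).
  exact: measurableT_comp mf (measurable_shift r).
rewrite -!integral_itv_bndo_bndc//; last exact: measurable_funS mSr.
have itvU (a b c : R) : a <= b -> b <= c ->
    `[a, c[%classic = `[a, b[ `|` `[b, c[.
  move=> ab bc; apply/seteqP; split=> x /=; rewrite !in_itv/=.
    by move=> /andP[-> xc]; case: (ltP x b) => xb; [left|right].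
  case=> /andP[h1 h2]; apply/andP; split=> //.
  - exact: lt_le_trans bc.
  - exact: le_trans h1.
have dis (a b c : R) : [disjoint `[a, b[%classic & `[b, c[%classic].
  apply/disj_setPS => x /= [] /=; rewrite !in_itv/= => /andP[_ xb] /andP[bx _].
  by move: (lt_le_trans xb bx); rewrite ltxx.
rewrite ge0_integral_shift_itvco// add0r.
rewrite (itvU _ 1)//; [|exact: ltW|by rewrite lerDl].
rewrite ge0_integral_setU//; last exact: mS.
have -> : `[1, 1 + r[%classic = `[0 + 1, r + 1[%classic :> set R.
  by rewrite add0r addrC.
rewrite -ge0_integral_shift_itvco//.
under [X in (_ + X)%E]eq_integral => x _.
  rewrite (fper x); first by over.
  by rewrite addrC addKr rpred1.
rewrite [in RHS](itvU _ r)//; last exact: ltW.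
by rewrite [RHS]ge0_integral_setU//; [rewrite addeC|exact: mS].
Qed.

End LebesgueShift.

Section CubeShift.
Context {R : realType}.
Local Notation MR := (measurableTypeR R).

Definition cube_shift d (v : 'I_d -> R) (t : d.-tuple MR) : d.-tuple MR :=
  [tuple (tnth t i : R) + v i | i < d].

Lemma measurable_cube_shift d (v : 'I_d -> R) : measurable_fun setT (cube_shift v).
Proof.
apply/measurable_fun_tnthP => i.
rewrite (_ : _ \o _ = (fun t : d.-tuple MR => (tnth t i : R) + v i)).
  by apply: measurable_funD => //; exact: measurable_tnth.
by apply/funext => t /=; rewrite tnth_mktuple.
Qed.

Lemma cube_shift_cons d (v : 'I_d.+1 -> R) (x : MR) (t : d.-tuple MR) :
  cube_shift v (tuple_cons (x, t)) =
  tuple_cons ((x : R) + v ord0, cube_shift (fun i => v (lift ord0 i)) t).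
Proof.
apply: eq_from_tnth => i; rewrite tnth_mktuple.
case: (unliftP ord0 i) => [j ->|->]; rewrite /tuple_cons/= ?tnthS ?tnth0//.
by rewrite tnth_mktuple.
Qed.

Definition periodic_cube d (f : d.-tuple MR -> \bar R) :=
  forall t u : d.-tuple MR,
    (forall i, (tnth u i : R) - tnth t i \is a Num.int) -> f u = f t.

Lemma ge0_integral_cube_cons d (f : d.+1.-tuple MR -> \bar R) :
  measurable_fun setT f -> (forall t, 0 <= f t)%E ->
  (\int[cube_measure R d.+1]_t f t =
   \int[uniform_prob (@ltr01 R)]_x \int[cube_measure R d]_t f (tuple_cons (x, t)))%E.
Proof.
move=> mf f0; rewrite [LHS](ge0_integral_pushforward (@measurable_tuple_cons R d))//.
rewrite fubini_tonelli1//; last by move=> p; exact: f0.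
exact: measurableT_comp mf (@measurable_tuple_cons R d).
Qed.

(** Induction on the dimension: the induction hypothesis removes the shift of the tail, the
    one-dimensional periodic case that of the head. *)
Lemma ge0_integral_cube_shift d (v : 'I_d -> R) (f : d.-tuple MR -> \bar R) :
  measurable_fun setT f -> (forall t, 0 <= f t)%E -> periodic_cube f ->
  (\int[cube_measure R d]_t f (cube_shift v t) = \int[cube_measure R d]_t f t)%E.
Proof.
elim: d v f => [|d IH] v f mf f0 fper.
  by apply: eq_integral => t _; congr f; rewrite [LHS]tuple0 [RHS]tuple0.
have mfs : measurable_fun setT (fun t => f (cube_shift v t)).
  exact: measurableT_comp mf (measurable_cube_shift v).
have mfc : measurable_fun setT (fun p => f (@tuple_cons R d p)).
  exact: measurableT_comp mf (@measurable_tuple_cons R d).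
rewrite !ge0_integral_cube_cons//.
under eq_integral => x _.
  under eq_integral do rewrite cube_shift_cons.
  rewrite (IH _ (fun t => f (tuple_cons ((x : R) + v ord0, t)))); first over.
  - exact: measurableT_comp mfc (measurable_pair1 _).
  - by [].
  - move=> t u tu; apply: fper => i.
    case: (unliftP ord0 i) => [j ->|->]; rewrite /tuple_cons/= ?tnthS ?tnth0//.
    by rewrite subrr rpred0.
(* Only the head is still shifted. Tonelli on both sides makes it the inner variable, where the
   one-dimensional case applies. *)
eapply etrans.
  apply: (fubini_tonelli
    (fun p : MR * d.-tuple MR => f (tuple_cons ((p.1 : R) + v ord0, p.2)))) => //.
  apply: (measurableT_comp mfc); apply: measurable_fun_pair => //.
  exact: measurableT_comp (measurable_shift (v ord0)) measurable_fst.
apply: esym; eapply etrans.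
  by apply: (fubini_tonelli (fun p : MR * d.-tuple MR => f (tuple_cons p))).
apply: esym.
apply: eq_integral => t _ /=.
have mft : measurable_fun setT (fun x => f (tuple_cons (x, t))).
  exact: measurableT_comp mfc (measurable_pair2 _).
rewrite !integral_uniform//; last first.
  exact: measurableT_comp mft (measurable_shift (v ord0)).
congr (_ * _)%E.
apply: (ge0_integral_periodic_shift (f := fun x => f (tuple_cons (x, t)))) => //.
move=> x y xy; apply: fper => i.
case: (unliftP ord0 i) => [j ->|->]; rewrite /tuple_cons/= ?tnthS ?tnth0//.
by rewrite subrr rpred0.
Qed.

End CubeShift.

Section HaarShift.
Context {R : realType} {d : nat}.
Local Notation MR := (measurableTypeR R).
Local Notation T := (torus R d).

Lemma ge0_integral_haar (f : T -> \bar R) :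
  measurable_fun setT f -> (forall x, 0 <= f x)%E ->
  (\int[haar]_x f x = \int[cube_measure R d]_t f (tuple_torus t))%E.
Proof.
by move=> mf f0; rewrite [LHS](ge0_integral_pushforward (@measurable_tuple_torus R d)).
Qed.

Lemma ge0_integral_haar_shift (a : T) (f : T -> \bar R) :
  measurable_fun setT f -> (forall x, 0 <= f x)%E ->
  (\int[haar]_x f (x + a)%R = \int[haar]_x f x)%E.
Proof.
move=> mf f0; have [w <-] := tproj_surj a.
rewrite !ge0_integral_haar//; last exact: measurableT_comp mf (measurable_tshift _).
have mft : measurable_fun setT (fun t => f (@tuple_torus R d t)).
  exact: measurableT_comp mf (@measurable_tuple_torus R d).
rewrite -(ge0_integral_cube_shift (fun i => w i 0) mft)//.
  apply: eq_integral => t _; rewrite /tuple_torus -tprojD; congr (f (tproj _)).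
  by apply/colP => i; rewrite !mxE tnth_mktuple.
move=> t u tu; rewrite /tuple_torus; congr f.
rewrite -[tuple_col u](subrK (tuple_col t)) tprojD tproj_eq0 ?add0r//.
by apply/mxOverP => i j; rewrite !mxE.
Qed.

Lemma integrable_haar_shift (a : T) (f : T -> \bar R) :
  haar.-integrable setT f -> haar.-integrable setT (fun x => f (x + a)).
Proof.
move=> /integrableP[mf intf]; apply/integrableP; split.
  exact: measurableT_comp mf (measurable_tshift _).
rewrite (ge0_integral_haar_shift a (f := fun x => `|f x|)%E)//.
exact: measurableT_comp.
Qed.

Lemma integral_haar_shift (a : T) (f : T -> \bar R) : haar.-integrable setT f ->
  (\int[haar]_x f (x + a)%R = \int[haar]_x f x)%E.
Proof.
move=> intf; have [mf _] := integrableP _ _ _ intf.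
rewrite [LHS]integralE [RHS]integralE; congr (_ - _)%E.
  rewrite -(ge0_integral_haar_shift a (f := f^\+%E))//; last first.
    exact: measurable_funepos.
  by rewrite -[fun x : T => f (x + a)%R]/(f \o (fun x => x + a)) funepos_comp.
rewrite -(ge0_integral_haar_shift a (f := f^\-%E))//; last first.
  exact: measurable_funeneg.
by rewrite -[fun x : T => f (x + a)%R]/(f \o (fun x => x + a)) funeneg_comp.
Qed.

End HaarShift.

(** * Calculus and integration by parts *)

Section Shift.
Context {R : realType}.

Lemma derivable_shift0 (g : R -> R) (s : R) :
  derivable (fun h => g (h + s)) 0 1 -> derivable g s 1.
Proof.
by rewrite /derivable; under eq_fun do rewrite /= !scaler1 addr0 add0r;
   under [in X in _ -> X]eq_fun do rewrite /= !scaler1.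
Qed.

Lemma derive1_shift0 (g : R -> R) (s : R) :
  derive1 g s = derive1 (fun h => g (h + s)) 0.
Proof.
by rewrite /derive1; under [in RHS]eq_fun do rewrite /= addr0 add0r.
Qed.

End Shift.

Section TorusCalculus.
Context {R : realType} {d : nat}.
Local Notation T := (torus R d).
Implicit Types (f g : T -> R) (F G : T -> 'cV[R]_d).

Lemma line0 f i x : line f i x 0 = f x.
Proof. by rewrite /line scale0r tproj0 addr0. Qed.

(** Moving the parameter along a line is the same as moving its base point. Hence facts at parameter
    0, the only ones in [C1] and [pderiv], hold at every parameter. *)
Lemma line_shift f i x s :
  (fun h => line f i x (h + s)) = line f i (x + tproj (s *: delta_mx i 0)).
Proof. by apply/funext => h; rewrite /line scalerDl tprojD (addrC (tproj _)) addrA. Qed.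

Lemma derivable_line f i x s : C1 f -> derivable (line f i x) s 1.
Proof. by case=> _ df _; apply: derivable_shift0; rewrite line_shift. Qed.

Lemma derive1_line f i x s :
  derive1 (line f i x) s = pderiv i f (x + tproj (s *: delta_mx i 0)).
Proof. by rewrite derive1_shift0 line_shift. Qed.

Lemma pderivD f g i x : derivable (line f i x) 0 1 -> derivable (line g i x) 0 1 ->
  pderiv i (fun y => f y + g y) x = pderiv i f x + pderiv i g x.
Proof. by move=> df dg; rewrite /pderiv !derive1E -deriveD. Qed.

Lemma pderivZ f i x (c : R) : derivable (line f i x) 0 1 ->
  pderiv i (fun y => c * f y) x = c * pderiv i f x.
Proof.
move=> df; rewrite /pderiv !derive1E.
by rewrite -[RHS](deriveZ c df).
Qed.

Lemma pderivM f g i x : derivable (line f i x) 0 1 -> derivable (line g i x) 0 1 ->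
  pderiv i (fun y => f y * g y) x = f x * pderiv i g x + pderiv i f x * g x.
Proof.
move=> df dg; rewrite /pderiv !derive1E.
have -> : line (fun y => f y * g y) i x = line f i x * line g i x by [].
by rewrite deriveM// !line0 [in RHS](mulrC _ (g x)).
Qed.

Lemma C1_cst (c : R) : C1 (fun _ : T => c).
Proof.
have dc i x : derivable (line (fun _ : T => c) i x) 0 1 by exact: derivable_cst.
split=> // [|i]; first exact: cst_continuous.
have -> : pderiv i (fun _ : T => c) = fun=> 0.
  by apply/funext => x; rewrite /pderiv derive1E; exact: derive_cst.
exact: cst_continuous.
Qed.

Lemma C1_add f g : C1 f -> C1 g -> C1 (fun x => f x + g x).
Proof.
move=> [cf df cdf] [cg dg cdg]; split=> [x|i x|i x].
- by apply: continuousD; [exact: cf|exact: cg].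
- by apply: derivableD; [exact: df|exact: dg].
- have -> : pderiv i (fun x => f x + g x) = pderiv i f \+ pderiv i g.
    by apply/funext => y; rewrite pderivD.
  by apply: continuousD; [exact: cdf|exact: cdg].
Qed.

Lemma C1_scale (c : R) f : C1 f -> C1 (fun x => c * f x).
Proof.
move=> [cf df cdf]; split=> [x|i x|i x].
- by apply: continuousM; [exact: cst_continuous|exact: cf].
- by apply: derivableZ; exact: df.
- have -> : pderiv i (fun x => c * f x) = fun x => c * pderiv i f x.
    by apply/funext => y; rewrite pderivZ.
  by apply: continuousM; [exact: cst_continuous|exact: cdf].
Qed.

Lemma C1_mul f g : C1 f -> C1 g -> C1 (fun x => f x * g x).
Proof.
move=> [cf df cdf] [cg dg cdg]; split=> [x|i x|i x].
- by apply: continuousM; [exact: cf|exact: cg].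
- by apply: derivableM; [exact: df|exact: dg].
- have -> : pderiv i (fun x => f x * g x) =
      (fun x => f x * pderiv i g x + pderiv i f x * g x).
    by apply/funext => y; rewrite pderivM.
  apply: (@continuousD _ _ _ (fun y => f y * pderiv i g y)
    (fun y => pderiv i f y * g y)); apply: continuousM;
    [exact: cf|exact: cdg|exact: cdf|exact: cg].
Qed.

Lemma C1_sum (I : Type) (r : seq I) (h : I -> T -> R) :
  (forall j, C1 (h j)) -> C1 (fun x => \sum_(j <- r) h j x).
Proof.
move=> ch; elim: r => [|j r IH].
  by under eq_fun do rewrite big_nil; exact: C1_cst.
by under eq_fun do rewrite big_cons; exact: C1_add.
Qed.

Lemma integral_pderiv f i : C1 f -> \int[haar]_x pderiv i f x = 0.
Proof.
move=> C1f; have [cf _ cdf] := C1f.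
pose u (s : R) (x : T) := line f i x s.
have cu s : continuous (u s).
  move=> x; apply: continuous_comp; last exact: cf.
  exact: continuous_tshift.
have [M dM] := torus_bounded (cdf i).
have := @differentiation_under_integral R _ T haar u setT measurableT 0 (-1) 1.
(* A constant dominates: the derivative in [s] is [pderiv i f] at a translated point. *)
move=> /(_ _ _ _ (cst M)).
have -> : (fun x' => \int[haar]_y u x' y) = cst (\int[haar]_y f y).
  apply/funext => s; rewrite /Rintegral /u /line; congr fine.
  rewrite (integral_haar_shift _ (f := fun x => (f x)%:E))//.
  exact: continuous_integrable_torus.
rewrite derive1_cst => h.
rewrite (_ : pderiv i f = partial1of2 u 0); last first.
  by apply/funext => x; rewrite /partial1of2.
apply/esym/h => //.
- by rewrite /= in_itv/= ltrN10 ltr01.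
- by move=> s _; exact: continuous_integrable_torus.
- by move=> s x _ _; exact: derivable_line.
- by move=> x; rewrite (le_trans _ (dM x)).
- by apply: continuous_integrable_torus; exact: cst_continuous.
- by move=> s x _ _; rewrite /partial1of2 derive1_line.
Qed.

Lemma RintegralD_torus f g : continuous f -> continuous g ->
  \int[haar]_x (f x + g x) = \int[haar]_x f x + \int[haar]_x g x.
Proof.
by move=> cf cg; rewrite RintegralD//; exact: continuous_integrable_torus.
Qed.

Lemma RintegralB_torus f g : continuous f -> continuous g ->
  \int[haar]_x (f x - g x) = \int[haar]_x f x - \int[haar]_x g x.
Proof.
by move=> cf cg; rewrite RintegralB//; exact: continuous_integrable_torus.
Qed.

Lemma RintegralZ_torus (c : R) f : continuous f ->
  \int[haar]_x (c * f x) = c * \int[haar]_x f x.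
Proof.
by move=> cf; rewrite RintegralZl//; exact: continuous_integrable_torus.
Qed.

Lemma Rintegral_sum_torus (I : Type) (r : seq I) (h : I -> T -> R) :
  (forall j, continuous (h j)) ->
  \int[haar]_x (\sum_(j <- r) h j x) = \sum_(j <- r) \int[haar]_x h j x.
Proof.
move=> ch; elim: r => [|j r IH].
  rewrite big_nil; under eq_Rintegral do rewrite big_nil.
  by rewrite Rintegral_cst// mul0r.
rewrite big_cons -IH -RintegralD_torus//; last exact: continuous_sumr.
by apply: eq_Rintegral => x _; rewrite big_cons.
Qed.

Lemma integral_by_parts e G : C1 e -> C1_field G ->
  \int[haar]_x (e x * divergence G x) =
  - \int[haar]_x (\sum_i pderiv i e x * G x i 0).
Proof.
move=> C1e C1G; apply/eqP; rewrite -addr_eq0.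
have [ce de cde] := C1e.
have cG i : continuous (fun x => G x i 0) by case: (C1G i).
have cdG i : continuous (pderiv i (fun x => G x i 0)) by case: (C1G i).
rewrite -RintegralD_torus; last 2 first.
- move=> x; apply: continuousM; first exact: ce.
  exact: (@continuous_sumr _ _ _ _ (fun i => pderiv i (fun x => G x i 0))).
- apply: (@continuous_sumr _ _ _ _ (fun i x => pderiv i e x * G x i 0)) => i x.
  by apply: continuousM; [exact: cde|exact: cG].
rewrite (_ : (fun x => _) = fun x => \sum_i pderiv i (fun y => e y * G y i 0) x).
  rewrite (@Rintegral_sum_torus _ _ (fun i => pderiv i (fun y => e y * G y i 0))).
    by apply/eqP/big1 => i _; apply: integral_pderiv; apply: C1_mul.
  by move=> i; have [] := C1_mul C1e (C1G i).
apply/funext => x; rewrite /divergence mulr_sumr -big_split; apply: eq_bigr => i _.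
by rewrite pderivM//; case: (C1G i).
Qed.

End TorusCalculus.

(** * Convolution *)

Section TorusSub.
Context {R : realType} {d : nat}.
Local Notation T := (torus R d).

Definition rat_box (q : {ffun 'I_d -> rat * rat}) : set 'cV[R]_d :=
  [set v | forall i, ratr (q i).1 < v i 0 < ratr (q i).2].

Lemma nbhs_rat_box (v : 'cV[R]_d) (U : set 'cV[R]_d) :
  nbhs v U -> exists2 q, rat_box q v & rat_box q `<=` U.
Proof.
move=> [P vP PU].
have ex i : exists q : rat * rat, ratr q.1 < v i 0 < ratr q.2 /\
    forall x : R, ratr q.1 < x < ratr q.2 -> P i 0 x.
  have := vP i 0; rewrite -nbhs_ballE => -[e /= e0 eP].
  have va : v i 0 - e < v i 0 by rewrite ltrBlDr ltrDl.
  have vb : v i 0 < v i 0 + e by rewrite ltrDl.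
  have [a] := rat_in_itvoo va; rewrite in_itv /= => /andP[ea av].
  have [b] := rat_in_itvoo vb; rewrite in_itv /= => /andP[bv eb].
  exists (a, b); split=> /= [|x]; first by rewrite av bv.
  move=> /andP[ax xb]; apply: eP; rewrite /ball /= ltr_distlC.
  by rewrite (lt_trans ea ax) (lt_trans xb eb).
have /choice[q qP] := ex.
exists [ffun i => q i] => [i|w qw]; first by rewrite ffunE; exact: (qP i).1.
by apply: PU => i j; rewrite ord1; apply: (qP i).2; have := qw i; rewrite ffunE.
Qed.

Lemma open_rat_box q : open (rat_box q).
Proof.
rewrite openE => v qv; exists (fun i _ => `](ratr (q i).1), (ratr (q i).2)[%classic).
  move=> i j; rewrite ord1; apply: open_nbhs_nbhs; split; first exact: interval_open.
  by rewrite /= in_itv/=; exact: qv.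
by move=> w /= qw i; have := qw i 0; rewrite in_itv.
Qed.

(** The preimage of the image of [U] is the union of the integer translates of [U]. *)
Lemma tproj_open (U : set 'cV[R]_d) : open U -> open (@tproj R d @` U).
Proof.
move=> oU.
suff : open (@tproj R d @^-1` (@tproj R d @` U)) by [].
have -> : @tproj R d @^-1` (@tproj R d @` U) =
    \bigcup_(n in [set` @int_vector R d]) ((fun v => v + n) @^-1` U).
  apply/seteqP; split => [v [u Uu uv]|v [n /= nZ Uvn]].
    exists (u - v); last by rewrite /= addrC subrK.
    by rewrite /= Quotient.idealrBE; exact/eqP.
  by exists (v + n) => //; rewrite tprojD (tproj_eq0 nZ) addr0.
apply: bigcup_open => n _; move: oU.
have /continuousP : continuous (fun v : 'cV[R]_d => v + n); last exact.
by move=> v; apply: (@continuousD _ _ _ id (cst n));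
  [exact: cvg_id|exact: cst_continuous].
Qed.

(* The torus is second countable, so the Borel sets of T * T are generated by
   the rectangles. *)
Lemma measurable_torus_sub : measurable_fun setT (fun p : T * T => p.1 - p.2).
Proof.
apply: (@measurability _ _ _ _ _ _ (@open T)) => // _ [U oU <-].
rewrite setTI.
(* Pairs of rational boxes whose images subtract into [U]. There are countably many, and their
   images are open, so the union below is a countable union of measurable rectangles. *)
pose D := [set q : {ffun 'I_d -> rat * rat} * {ffun 'I_d -> rat * rat} |
  forall v w, rat_box q.1 v -> rat_box q.2 w -> U (tproj v - tproj w)].
have -> : (fun p : T * T => p.1 - p.2) @^-1` U =
    \bigcup_(q in D) ((@tproj R d @` rat_box q.1) `*` (@tproj R d @` rat_box q.2)).
  apply/seteqP; split=> [[x y] /= Uxy|[x y] [q Dq /= [[v qv <-] [w qw <-]]]].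
    have [v vx] := tproj_surj x; have [w wy] := tproj_surj y.
    have csub : continuous (fun p : 'cV[R]_d * 'cV[R]_d => p.1 - p.2).
      by move=> p; apply: continuousB; [exact: cvg_fst|exact: cvg_snd].
    have oV : open (@tproj R d @^-1` U) by [].
    have nVW : nbhs (v, w) ((fun p : 'cV[R]_d * 'cV[R]_d => p.1 - p.2) @^-1`
        (@tproj R d @^-1` U)).
      apply: csub; apply: open_nbhs_nbhs; split=> //=.
      by rewrite tprojB vx wy.
    have [[A B] /= [nA nB] AB] := nVW.
    have [q qv qA] := nbhs_rat_box nA.
    have [r rw rB] := nbhs_rat_box nB.
    exists (q, r) => /=; last by split; [exists v|exists w].
    move=> v' w' qv' rw'; rewrite -tprojB.
    by apply: (AB (v', w')); split; [exact: qA|exact: rB].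
  exact: Dq.
rewrite bigcup_mkcond; apply: countable_bigcupT_measurable => [|q].
  exact: countableP.
case: ifP => // _; apply: measurableX.
  by apply: sub_sigma_algebra; apply: tproj_open; exact: open_rat_box.
by apply: sub_sigma_algebra; apply: tproj_open; exact: open_rat_box.
Qed.

Lemma measurable_torus_subl (x : T) : measurable_fun setT (fun y : T => x - y).
Proof. exact: measurableT_comp measurable_torus_sub (measurable_pair1 _). Qed.

End TorusSub.

Section Convolution.
Context {R : realType} {d : nat}.
Local Notation T := (torus R d).
Implicit Types (k f g : T -> R).

Lemma kernel_measurable k : smoothing_kernel k -> measurable_fun setT k.
Proof. by case=> _ _ /integrableP[/measurable_EFinP]. Qed.

Lemma integrable_kernel_shift k (x : T) : smoothing_kernel k ->
  haar.-integrable setT (fun y => (k (x - y))%:E).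
Proof.
case=> ke _ kint; under eq_fun do rewrite -ke opprB.
exact: (integrable_haar_shift (- x) kint).
Qed.

Lemma integral_kernel_shift k (x : T) : smoothing_kernel k ->
  (\int[haar]_y (k (x - y))%:E = \int[haar]_y (k y)%:E)%E.
Proof.
case=> ke _ kint; under eq_integral do rewrite -ke opprB.
exact: (integral_haar_shift (- x) kint).
Qed.

Lemma integrable_conv k f (x : T) : smoothing_kernel k -> continuous f ->
  haar.-integrable setT (fun y => (k (x - y) * f y)%:E).
Proof.
move=> kk cf.
have := integrableMl measurableT (integrable_kernel_shift x kk)
  (continuous_measurable_torus cf).
apply; have [M fM] := torus_bounded cf.
exists M; split=> [|r Mr y _ /=]; first exact: num_real.
exact: le_trans (fM y) (ltW Mr).
Qed.

Lemma convolutionB k f g : smoothing_kernel k -> continuous f -> continuous g ->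
  (fun x => convolution k f x - convolution k g x) =
  convolution k (fun x => f x - g x).
Proof.
move=> kk cf cg; apply/funext => x; rewrite /convolution -RintegralB//; last 2 first.
- exact: integrable_conv.
- exact: integrable_conv.
by apply: eq_Rintegral => y _; rewrite mulrBr.
Qed.

(** Fubini for [k (x - y) * k (y - z) * f z]. As [k] is only integrable, the integral defining
    [convolution k k] may diverge at some points, so the two integrands in [z] are identified only
    almost everywhere. *)
Lemma convolutionA k f : smoothing_kernel k -> continuous f ->
  convolution k (convolution k f) = convolution (convolution k k) f.
Proof.
move=> kk cf; have mk := kernel_measurable kk; have [ke k0 kint] := kk.
apply/funext => x.
pose F1 (p : T * T) : R := k (x - p.1) * k (p.1 - p.2).
pose F (p : T * T) : R := F1 p * f p.2.
have mF1 : measurable_fun setT F1.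
  apply: measurable_funM.
    apply: (measurableT_comp mk).
    exact: measurableT_comp (measurable_torus_subl x) measurable_fst.
  exact: measurableT_comp mk measurable_torus_sub.
have F10 p : 0 <= F1 p by rewrite mulr_ge0.
(* Tonelli: integrating in [z] first leaves [k (x - y)] times the mass of [k], and integrating in
   [y] gives the square of that mass. *)
have intF1 : (haar \x haar)%E.-integrable setT (EFin \o F1).
  apply/integrable12ltyP; first exact/measurable_EFinP.
  have absF1 y : (\int[haar]_z `|(EFin \o F1) (y, z)| =
      (k (x - y))%:E * \int[haar]_y (k y)%:E)%E.
    rewrite -(integral_kernel_shift y kk) -ge0_integralZl//.
    - by apply: eq_integral => z _; rewrite /= ger0_norm.
    - apply/measurable_EFinP; apply: (measurableT_comp mk).
      exact: measurable_torus_subl.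
    - by move=> z _; rewrite lee_fin.
    - by rewrite lee_fin.
  under eq_integral do rewrite absF1.
  rewrite /= ge0_integralZr//; last 3 first.
  - apply/measurable_EFinP; apply: (measurableT_comp mk).
    exact: measurable_torus_subl.
  - by move=> y _; rewrite lee_fin.
  - by apply: integral_ge0 => y _; rewrite lee_fin.
  rewrite integral_kernel_shift//.
  rewrite lte_mul_pinfty//.
  - by apply: integral_ge0 => y _; rewrite lee_fin.
  - exact: integrable_fin_num.
  - by rewrite ltey_eq integrable_fin_num.
have [M fM] := torus_bounded cf.
have mf := continuous_measurable_torus cf.
have intF : (haar \x haar)%E.-integrable setT (EFin \o F).
  have := integrableMl measurableT intF1 (measurableT_comp mf measurable_snd).
  apply; exists M; split=> [|r Mr y _ /=]; first exact: num_real.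
  exact: le_trans (fM _) (ltW Mr).
have inner y : (\int[haar]_z (F (y, z))%:E = (k (x - y) * convolution k f y)%:E)%E.
  rewrite /convolution EFinM /Rintegral fineK; last first.
    exact: integrable_fin_num (integrable_conv y kk cf).
  rewrite -integralZl//; last exact: integrable_conv.
  by apply: eq_integral => z _; rewrite /F/F1/= -mulrA EFinM.
(* Translating [y] by [z] identifies the marginal of [F1] with [convolution k k] at [x - z]; this
   also yields the measurability of the latter. *)
have F1K z : (\int[haar]_y (F1 (y, z))%:E = \int[haar]_y (k (x - z - y) * k y)%:E)%E.
  rewrite -(ge0_integral_haar_shift z (f := fun y => (F1 (y, z))%:E))//; last 2 first.
  - apply/measurable_EFinP; apply: (measurableT_comp mF1).
    exact: measurable_pair2.
  - by move=> y; rewrite lee_fin.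
  by apply: eq_integral => y _; rewrite /F1/= addrK opprD addrA addrAC.
rewrite -[LHS]/(fine (\int[haar]_y (k (x - y) * convolution k f y)%:E)).
rewrite -[RHS]/(fine (\int[haar]_z (convolution k k (x - z) * f z)%:E)).
congr fine.
under eq_integral do rewrite -inner.
have mKt : measurable_fun setT (fun z : T => convolution k k (x - z)).
  rewrite /convolution /Rintegral; under eq_fun do rewrite -F1K.
  apply: (measurableT_comp (@fine_measurable R setT measurableT)).
  exact: (measurable_fubini_G intF1).
rewrite (Fubini intF); apply: ae_eq_integral => //.
- exact: (measurable_fubini_G intF).
- by apply/measurable_EFinP; exact: measurable_funM.
have := ae_integrable2 intF1; apply: filterS => z intz _.
rewrite /F /=; under eq_integral do rewrite EFinM.
rewrite integralZr// [RHS]EFinM; congr (_ * _)%E.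
rewrite F1K /convolution/Rintegral fineK// -F1K.
exact: integrable_fin_num intz.
Qed.

End Convolution.

(** * Flat distance and Lipschitz drifts *)

Section EuclideanNorm.
Context {R : realType} {d : nat}.
Implicit Types (u v : 'cV[R]_d).

(** A nonnegative binary quadratic form has nonpositive discriminant. It serves the Cauchy-Schwarz
    inequalities in R^d and in L^2 and the first-order condition at the minimiser of the Rayleigh
    quotient. *)
Lemma discriminant_le (U V P : R) :
  (forall a b : R, 0 <= a ^+ 2 * U - a * b * P *+ 2 + b ^+ 2 * V) ->
  P ^+ 2 <= U * V.
Proof.
move=> h; have U0 : 0 <= U.
  by have := h 1 0; rewrite expr1n expr0n/= mulr0 !mul0r mul0rn subr0 addr0 mul1r.
have [U0'|U0'] := eqVneq U 0.
  have [->|P0] := eqVneq P 0; first by rewrite U0' expr0n mul0r.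
  (* With [U = 0] the form is affine in [a] for [b = 1]; this choice of [a] gives it the value
     -1. *)
  have := h ((V + 1) / (P *+ 2)) 1.
  have -> : (V + 1) / (P *+ 2) * 1 * P *+ 2 = V + 1 by field.
  rewrite U0' mulr0 expr1n sub0r mul1r opprD addrAC addNr add0r.
  by rewrite lerNr oppr0 ler10.
have Ugt0 : 0 < U by rewrite lt_def U0' U0.
have := h P U.
have -> : P ^+ 2 * U - P * U * P *+ 2 + U ^+ 2 * V = U * (U * V - P ^+ 2) by ring.
by rewrite pmulr_rge0// subr_ge0.
Qed.

Lemma enorm_ge0 v : 0 <= enorm v.
Proof. exact: sqrtr_ge0. Qed.

Lemma enorm_sqr v : enorm v ^+ 2 = \sum_i v i 0 ^+ 2.
Proof. by rewrite sqr_sqrtr// sumr_ge0// => i _; exact: sqr_ge0. Qed.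

Lemma enorm0 : enorm (0 : 'cV[R]_d) = 0.
Proof. by rewrite /enorm big1 ?sqrtr0// => i _; rewrite mxE expr0n. Qed.

Lemma le_enorm v i : `|v i 0| <= enorm v.
Proof.
rewrite -(ler_pXn2r (n := 2))// ?nnegrE ?enorm_ge0// enorm_sqr real_normK ?num_real//.
by rewrite (bigD1 i)//= lerDl sumr_ge0// => j _; exact: sqr_ge0.
Qed.

Lemma cauchy_schwarz_enorm u v : `|\sum_i u i 0 * v i 0| <= enorm u * enorm v.
Proof.
rewrite -(ler_pXn2r (n := 2))// ?nnegrE ?mulr_ge0 ?enorm_ge0//.
rewrite exprMn !enorm_sqr real_normK ?num_real//; apply: discriminant_le => a b.
have -> : a ^+ 2 * (\sum_i u i 0 ^+ 2) - a * b * (\sum_i u i 0 * v i 0) *+ 2 +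
    b ^+ 2 * (\sum_i v i 0 ^+ 2) = \sum_i (a * u i 0 - b * v i 0) ^+ 2.
  rewrite -mulrnAl !mulr_sumr -sumrB -big_split/=.
  by apply: eq_bigr => i _; ring.
by apply: sumr_ge0 => i _; exact: sqr_ge0.
Qed.

Lemma continuous_enorm : continuous (@enorm R d).
Proof.
move=> v; apply: (@continuous_comp _ _ _ (fun v : 'cV[R]_d => \sum_i v i 0 ^+ 2)).
  apply: (@continuous_sumr _ _ _ _ (fun i (v : 'cV[R]_d) => v i 0 ^+ 2)) => i w.
  under eq_fun do rewrite expr2.
  by apply: continuousM; exact: coord_continuous.
exact: sqrt_continuous.
Qed.

Lemma continuous_enorm_field (F : torus R d -> 'cV[R]_d) :
  (forall i, continuous (fun x => F x i 0)) -> continuous (fun x => enorm (F x)).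
Proof.
move=> cF x; apply: (@continuous_comp _ _ _ (fun x => \sum_i F x i 0 ^+ 2)).
  apply: (@continuous_sumr _ _ _ _ (fun i x => F x i 0 ^+ 2)) => i y.
  under eq_fun do rewrite expr2.
  by apply: continuousM; exact: cF.
exact: sqrt_continuous.
Qed.

End EuclideanNorm.

Section FlatDistance.
Context {R : realType} {d : nat}.
Local Notation T := (torus R d).

(** [tdist x y] is convertible to [tnorm (x - y)], so that measurability in two variables reduces to
    one variable and subtraction. *)
Definition tnorm (z : T) : R := inf [set enorm v | v in [set v | tproj v = z]].

Lemma tnorm_nonempty (z : T) : [set enorm v | v in [set v | tproj v = z]] !=set0.
Proof. by have [v vz] := tproj_surj z; exists (enorm v), v. Qed.

Lemma tnorm_ge0 (z : T) : 0 <= tnorm z.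
Proof.
by apply: (lb_le_inf (tnorm_nonempty z)) => _ [v _ <-]; exact: enorm_ge0.
Qed.

Lemma tnorm_le (v : 'cV[R]_d) : tnorm (tproj v) <= enorm v.
Proof.
apply: ge_inf; last by exists v.
by exists 0 => _ [w _ <-]; exact: enorm_ge0.
Qed.

Lemma tnorm0 : tnorm 0 = 0.
Proof.
apply/eqP; rewrite eq_le tnorm_ge0 andbT -[leRHS](@enorm0 R d) -tproj0.
exact: tnorm_le.
Qed.

Lemma tnorm_bounded (z : T) : tnorm z <= Num.sqrt d%:R.
Proof.
have [v <- v01] := tproj_frac z.
apply: (le_trans (tnorm_le v)); rewrite ler_wsqrtr//.
rewrite -[leRHS](_ : \sum_(i < d) 1 = _); last by rewrite sumr_const card_ord.
apply: ler_sum => i _; have /andP[v0 v1] := v01 i.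
by rewrite expr_le1.
Qed.

(** A strict sublevel set is the projection of an open ball, and the projection is an open map. *)
Lemma measurable_tnorm : measurable_fun setT tnorm.
Proof.
apply: (measurability _ (RGenInftyO.measurableE R)).
move=> _ [_ [a ->] <-]; rewrite setTI.
apply: sub_sigma_algebra.
have -> : tnorm @^-1` `]-oo, a[ = @tproj R d @` (@enorm R d @^-1` `]-oo, a[).
  apply/seteqP; split=> [z /=|_ [v /= va <-]].
    rewrite in_itv/= => /(inf_lt (tnorm_nonempty z))[_ [v vz <-] va].
    by exists v => //=; rewrite in_itv.
  rewrite !in_itv/= in va *; exact: le_lt_trans (tnorm_le v) va.
apply: tproj_open; have /continuousP := @continuous_enorm R d; apply.
exact: interval_open.
Qed.

Lemma measurable_tdist : measurable_fun setT (fun p : T * T => tdist p.1 p.2).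
Proof. exact: measurableT_comp measurable_tnorm measurable_torus_sub. Qed.

(** The flat norm is bounded by the diagonal of the unit cube. This discharges the moment conditions
    in the drift assumptions. *)
Lemma finite_second_momentT (rho : probability T R) : finite_second_moment rho.
Proof.
apply: (@le_lt_trans _ _ (\int[rho]_x (d%:R)%:E)%E); last first.
  rewrite integral_cst// [X in (_ * X)%E](_ : _ = 1%E) ?mule1 ?ltry//.
  exact: probability_setT.
apply: ge0_le_integral => //.
- by move=> x _; rewrite lee_fin sqr_ge0.
- apply/measurable_EFinP; apply: measurable_funX.
  exact: measurableT_comp measurable_tdist (measurable_pair2 _).
- move=> x _; rewrite lee_fin -[leRHS]sqr_sqrtr ?ler0n//.
  by rewrite ler_pXn2r// ?nnegrE ?sqrtr_ge0 ?tnorm_ge0//; exact: tnorm_bounded.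
Qed.

Definition diag (x : T) : T * T := (x, x).

Lemma measurable_diag : measurable_fun setT diag.
Proof. exact: measurable_fun_pair. Qed.

HB.instance Definition _ := isMeasurableFun.Build _ _ _ _ diag measurable_diag.

(** The image of [rho] under [diag] is a coupling of zero cost. With it the Lipschitz assumption at
    a fixed measure becomes one in space alone. *)
Lemma W2_diag (rho : probability T R) : W2 rho rho = 0%E.
Proof.
rewrite /W2; set S := [set _ | _ in _].
have -> : ereal_inf S = 0%E; last by rewrite /= sqrtr0.
apply/eqP; rewrite eq_le; apply/andP; split; last first.
  apply: le_ereal_inf_tmp => _ [pi _ <-]; apply: integral_ge0 => p _.
  by rewrite lee_fin sqr_ge0.
apply: ereal_inf_lbound; exists (distribution rho diag).
  move=> A mA; split; rewrite /= /distribution/= /pushforward/=; congr (rho _);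
    by apply/seteqP; split=> x //= [].
rewrite [LHS](ge0_integral_pushforward measurable_diag)//.
- by apply: integral0_eq => x _; rewrite /= /tdist subrr -/(tnorm 0) tnorm0 expr0n.
- by apply/measurable_EFinP; apply: measurable_funX; exact: measurable_tdist.
- by move=> p _; rewrite lee_fin sqr_ge0.
Qed.

Lemma continuous_lipschitz_drift (b : T -> probability T R -> 'cV[R]_d) (L : R)
    (rho : probability T R) (i : 'I_d) :
  lipschitz_drift b L -> continuous (fun x => b x rho i 0).
Proof.
move=> bL; apply: continuous_torus => v.
(* The absolute value of [L] appears because its sign is not given here. *)
have lip w : `|b (tproj v) rho i 0 - b (tproj w) rho i 0| <= `|L| * enorm (v - w).
  have := bL (tproj v) (tproj w) rho rho
    (finite_second_momentT _) (finite_second_momentT _).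
  rewrite W2_diag adde0 -EFinM lee_fin => h.
  have := le_enorm (b (tproj v) rho - b (tproj w) rho) i.
  rewrite !mxE => /le_trans; apply; apply: (le_trans h).
  apply: (@le_trans _ _ (`|L| * tdist (tproj v) (tproj w))).
    by rewrite ler_wpM2r ?ler_norm//; exact: tnorm_ge0.
  by rewrite ler_wpM2l// /tdist -tprojB; exact: tnorm_le.
apply/(@cvgrPdist_le _ _ _ _ (nbhs_filter v)) => e e0.
have cphi : {for v, continuous (fun w : 'cV[R]_d => `|L| * enorm (v - w))}.
  apply: continuousM; first exact: cst_continuous.
  have cB : {for v, continuous (fun w : 'cV[R]_d => v - w)}.
    by apply: continuousB; [exact: cst_continuous|exact: cvg_id].
  exact: (continuous_comp cB (@continuous_enorm R d _)).
have := cphi _ (nbhsx_ballx _ e e0); apply: (@filterS _ _ (nbhs_filter v)) => w.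
rewrite /ball/= subrr enorm0 mulr0 sub0r normrN ger0_norm ?mulr_ge0 ?enorm_ge0// => /ltW.
exact: le_trans (lip w).
Qed.

End FlatDistance.

(** * Rayleigh quotients *)

Section Rayleigh.
Context {R : realType} {d : nat}.
Implicit Types (M : 'M[R]_d) (u v w : 'rV[R]_d).

Let bform M u v : R := (u *m M *m v^T) 0 0.

Let bformC M u v : M^T = M -> bform M u v = bform M v u.
Proof.
move=> sM; rewrite /bform.
have -> : (u *m M *m v^T) 0 0 = (u *m M *m v^T)^T 0 0 by rewrite [RHS]mxE.
by rewrite !trmx_mul trmxK sM mulmxA.
Qed.

Let bform_comb M (a b : R) u v : M^T = M ->
  bform M (a *: u + b *: v) (a *: u + b *: v) =
  a ^+ 2 * bform M u u + a * b * bform M u v *+ 2 + b ^+ 2 * bform M v v.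
Proof.
move=> sM; have := bformC v u sM; rewrite /bform.
rewrite !mulmxDl linearD/= !mulmxDr !linearZ/= -?scalemxAl.
move: (u *m M *m u^T) (u *m M *m v^T) (v *m M *m u^T) (v *m M *m v^T).
by move=> U P Q W C; rewrite !mxE C; ring.
Qed.

Let bformE M u v : bform M u v = \sum_i (u *m M) 0 i * v 0 i.
Proof. by rewrite /bform [LHS]mxE; apply: eq_bigr => i _; rewrite [v^T _ _]mxE. Qed.

Let sqn v := \sum_i v 0 i ^+ 2.

Let sqn_ge0 v : 0 <= sqn v.
Proof. by apply: sumr_ge0 => i _; exact: sqr_ge0. Qed.

Let sqn_eq0 v : sqn v = 0 -> v = 0.
Proof.
move=> /eqP; rewrite psumr_eq0 => [/allP v0|i _]; last exact: sqr_ge0.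
by apply/rowP => i; have := v0 i (mem_index_enum _); rewrite sqrf_eq0 mxE => /eqP.
Qed.

Let compact_sphere : compact [set v : 'rV[R]_d | sqn v = 1].
Proof.
apply: (@subclosed_compact _ _
  [set v : 'rV[R]_d | forall i, `[(-1 : R), 1]%classic (v ord0 i)]).
- have -> : [set v : 'rV[R]_d | sqn v = 1] = sqn @^-1` [set 1] by [].
  apply: preimage_closed; last exact: (@closed_eq _ 1).
  move=> w _; move: w.
  apply: (@continuous_sumr _ _ _ _ (fun i (v : 'rV[R]_d) => v 0 i ^+ 2)) => i w.
  under eq_fun do rewrite expr2.
  by apply: continuousM; exact: coord_continuous.
- by apply: (@rV_compact _ _ (fun=> `[(-1 : R), 1]%classic)) => i; exact: segment_compact.
- move=> v /= v1 i; rewrite in_itv/= -ler_norml.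
  rewrite -(ler_pXn2r (n := 2))// ?nnegrE// expr1n real_normK ?num_real// -v1.
  by rewrite /sqn (bigD1 i)//= lerDl sumr_ge0// => j _; exact: sqr_ge0.
Qed.

(** The quadratic form attains a minimum on the compact unit sphere; the minimum is an eigenvalue,
    hence at least [kappa], and homogeneity extends the bound to all vectors. The form lives on row
    vectors because [eigenvalue] is about left eigenvectors. *)
Lemma smallest_eigenvalue_le (A : 'M[R]_d) (kappa : R) (v : 'cV[R]_d) :
  A^T = A -> smallest_eigenvalue A kappa ->
  kappa * enorm v ^+ 2 <= \sum_i v i 0 * (A *m v) i 0.
Proof.
move=> sA [_ kmin].
pose q w := bform A w w.
have qZ (c : R) w : q (c *: w) = c ^+ 2 * q w.
  rewrite /q /bform !linearZ/= -?scalemxAl.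
  by move: (w *m A *m w^T) => W; rewrite !mxE; ring.
have sqnZ (c : R) w : sqn (c *: w) = c ^+ 2 * sqn w.
  by rewrite /sqn mulr_sumr; apply: eq_bigr => i _; rewrite mxE exprMn.
have unit w : w != 0 -> sqn ((Num.sqrt (sqn w))^-1 *: w) = 1.
  move=> w0; rewrite sqnZ exprVn sqr_sqrtr// mulVf//.
  by apply: contra w0 => /eqP/sqn_eq0 ->.
rewrite enorm_sqr.
have -> : \sum_i v i 0 * (A *m v) i 0 = q v^T.
  rewrite /q bformE; apply: eq_bigr => i _; rewrite -[A in RHS]sA -trmx_mul !mxE.
  by rewrite mulrC.
have -> : \sum_i v i 0 ^+ 2 = sqn v^T by apply: eq_bigr => i _; rewrite mxE.
move: v^T => {}v.
have [->|v0] := eqVneq v 0.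
  by rewrite -(scale0r (0 : 'rV_d)) sqnZ qZ expr0n !mul0r mulr0.
have [||c + cmin] := @compact_EVT_min _ _ q _ _ compact_sphere.
- by exists ((Num.sqrt (sqn v))^-1 *: v); exact: unit.
- apply: continuous_subspaceT; rewrite /q; under eq_fun do rewrite bformE.
  apply: (@continuous_sumr _ _ _ _ (fun i (w : 'rV[R]_d) => (w *m A) 0 i * w 0 i)) => i w.
  apply: continuousM; last exact: coord_continuous.
  move: w; rewrite (_ : (fun w => _) = fun w : 'rV[R]_d => \sum_j w 0 j * A j i).
    2: by apply/funext => w; rewrite mxE.
  apply: (@continuous_sumr _ _ _ _ (fun j (w : 'rV[R]_d) => w 0 j * A j i)) => j w.
  by apply: continuousM; [exact: coord_continuous|exact: cst_continuous].
rewrite inE/= => c1.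
have qmin w : q c * sqn w <= q w.
  have [->|w0] := eqVneq w 0.
    by rewrite -(scale0r (0 : 'rV_d)) sqnZ qZ expr0n !mul0r mulr0.
  have sw : 0 < sqn w.
    by rewrite lt_def sqn_ge0 andbT; apply: contra w0 => /eqP/sqn_eq0 ->.
  have := cmin ((Num.sqrt (sqn w))^-1 *: w); rewrite inE => /(_ (unit _ w0)).
  by rewrite qZ exprVn sqr_sqrtr// mulrC ler_pdivlMr.
suff ceig : eigenvalue A (q c).
  by apply: le_trans (qmin v); rewrite ler_wpM2r//; exact: kmin.
pose M := A - (q c)%:M.
have sM : M^T = M by rewrite /M linearB/= sA tr_scalar_mx.
have bM w : bform M w w = q w - q c * sqn w.
  rewrite /bform /M mulmxBr mulmxBl mxE [X in _ + X]mxE; congr (_ - _).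
  rewrite mul_mx_scalar -scalemxAl !mxE; congr (_ * _).
  by apply: eq_bigr => i _; rewrite mxE expr2.
(* By minimality the form of [M] is nonnegative, and it vanishes at [c]; the discriminant inequality
   then makes [c] orthogonal to every vector. *)
have orth w : bform M c w = 0.
  have : (- bform M c w) ^+ 2 <= 0 * bform M w w.
    apply: discriminant_le => a b.
    have -> : a ^+ 2 * 0 - a * b * - bform M c w *+ 2 + b ^+ 2 * bform M w w =
        bform M (a *: c + b *: w) (a *: c + b *: w).
      by rewrite bform_comb// (bM c) c1 mulr1 subrr; ring.
    by rewrite bM subr_ge0.
  rewrite mul0r sqrrN => h; apply/eqP; rewrite -sqrf_eq0 eq_le h sqr_ge0//.
apply/eigenvalueP; exists c; last first.
  apply: contra_eq_neq c1 => ->.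
  by rewrite -(scale0r (0 : 'rV_d)) sqnZ expr0n mul0r eq_sym oner_neq0.
apply/eqP; rewrite -subr_eq0 -mul_mx_scalar -mulmxBr -/M; apply/eqP/sqn_eq0.
(* Testing with [c *m M] gives its own squared norm, so [c *m M = 0]. *)
by rewrite /sqn -[RHS](orth (c *m M)) bformE; apply: eq_bigr => i _; rewrite expr2.
Qed.

End Rayleigh.

(** * Norms and almost everywhere bounds *)

Section TorusNorms.
Context {R : realType} {d : nat}.
Local Notation T := (torus R d).
Implicit Types f g : T -> R.

Definition L2n f : R := Num.sqrt (\int[haar]_x f x ^+ 2).

Lemma continuousX2 (X : topologicalType) (f : X -> R) :
  continuous f -> continuous (fun x => f x ^+ 2).
Proof.
by move=> cf x; under eq_fun do rewrite expr2; apply: continuousM; exact: cf.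
Qed.

Lemma Rintegral_sqr_ge0 f : 0 <= \int[haar]_x f x ^+ 2.
Proof. by apply: Rintegral_ge0 => x _; exact: sqr_ge0. Qed.

Lemma L2n_ge0 f : 0 <= L2n f.
Proof. exact: sqrtr_ge0. Qed.

Lemma L2n_sqr f : L2n f ^+ 2 = \int[haar]_x f x ^+ 2.
Proof. by rewrite sqr_sqrtr// Rintegral_sqr_ge0. Qed.

Lemma L2normE f : continuous f -> L2norm f = (L2n f)%:E.
Proof.
move=> cf; rewrite /L2norm unlock /=.
under eq_integral => x _ do rewrite powR_mulrn ?normr_ge0// real_normK ?num_real//.
have fin : (\int[haar]_x (f x ^+ 2)%:E)%E \is a fin_num.
  apply: integrable_fin_num => //.
  exact: (continuous_integrable_torus (continuousX2 cf)).
rewrite poweR12_sqrt; last by apply: integral_ge0 => x _; rewrite lee_fin sqr_ge0.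
by rewrite -(fineK fin).
Qed.

Lemma L2norm_fieldE (F : T -> 'cV[R]_d) : continuous (fun x => enorm (F x)) ->
  L2norm_field F = (L2n (fun x => enorm (F x)))%:E.
Proof. exact: L2normE. Qed.

Lemma cauchy_schwarz_torus f g : continuous f -> continuous g ->
  \int[haar]_x (f x * g x) <= L2n f * L2n g.
Proof.
move=> cf cg; apply: le_trans (ler_norm _) _.
rewrite -(ler_pXn2r (n := 2))// ?nnegrE ?mulr_ge0 ?L2n_ge0//.
rewrite exprMn !L2n_sqr real_normK ?num_real//; apply: discriminant_le => a b.
have cfg : continuous (fun x => f x * g x).
  by move=> x; apply: continuousM; [exact: cf|exact: cg].
have cZ (c : R) (h : T -> R) : continuous h -> continuous (fun x => c * h x).
  by move=> ch x; apply: continuousM; [exact: cst_continuous|exact: ch].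
have cf2 := continuousX2 cf; have cg2 := continuousX2 cg.
rewrite -mulrnAl -!RintegralZ_torus// -RintegralB_torus; [|exact: cZ..].
rewrite -RintegralD_torus; last 2 first.
- move=> x; apply: (@continuousB _ _ _ (fun x => a ^+ 2 * f x ^+ 2)
    (fun x => a * b *+ 2 * (f x * g x))); exact: cZ.
- exact: cZ.
apply: Rintegral_ge0 => x _.
have -> : a ^+ 2 * f x ^+ 2 - a * b *+ 2 * (f x * g x) + b ^+ 2 * g x ^+ 2 =
  (a * f x - b * g x) ^+ 2 by ring.
exact: sqr_ge0.
Qed.

(** The difference equals its absolute value almost everywhere, and the integral of the latter is
    nonnegative. This form suits bounds by essential suprema. *)
Lemma ae_le_Rintegral f g : continuous f -> continuous g ->
  (\forall x \ae haar, f x <= g x) ->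
  \int[haar]_x f x <= \int[haar]_x g x.
Proof.
move=> cf cg fg; rewrite -subr_ge0 -RintegralB_torus//.
have cgf : continuous (fun x => g x - f x).
  by move=> x; apply: continuousB; [exact: cg|exact: cf].
have -> : \int[haar]_x (g x - f x) = \int[haar]_x `|g x - f x|.
  rewrite /Rintegral; congr fine; apply: ae_eq_integral => //.
  - by apply/measurable_EFinP; exact: continuous_measurable_torus.
  - apply/measurable_EFinP; apply: measurableT_comp => //.
    exact: continuous_measurable_torus.
  - by apply: filterS fg => x fgx _; rewrite ger0_norm// subr_ge0.
by apply: Rintegral_ge0.
Qed.

Lemma Linfty_norm_ae f (M : \bar R) : (Linfty_norm f <= M)%E ->
  \forall x \ae haar, ((`|f x|)%:E <= M)%E.
Proof.
rewrite /Linfty_norm unlock [X in (0 < X)%E](@probability_setT _ _ _ haar) lte01.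
by move=> /ess_supP.
Qed.

Lemma Rintegral_density (f : density R d) : \int[haar]_x f x = 1.
Proof. by rewrite /Rintegral density_int1. Qed.

(** A density has mean 1 for a probability measure, so an upper bound cannot be smaller. This makes
    [rhobar] positive. *)
Lemma Linfty_norm_density_ge1 (f : density R d) (M : R) : continuous f ->
  (Linfty_norm f <= M%:E)%E -> 1 <= M.
Proof.
move=> cf /Linfty_norm_ae fM; rewrite -(Rintegral_density f).
rewrite -[leRHS]mulr1 -(_ : fine (@haar R d setT) = 1); last first.
  by rewrite [X in fine X](@probability_setT _ _ _ haar).
rewrite -(Rintegral_cst _ measurableT M); apply: ae_le_Rintegral => //.
  exact: cst_continuous.
by apply: filterS fM => x; rewrite lee_fin; exact: le_trans (ler_norm _).
Qed.

End TorusNorms.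

(** * Evolution of the energy *)

Section Gronwall.
Context {R : realType}.

(** The function [expR (alpha * t) * (E t - c / alpha)] is nonincreasing. A derivative is asked for
    only inside the interval, since the equations hold only at positive times. A nonpositive term
    [- c / alpha * expR (- alpha * b)] is dropped at the end. *)
Lemma gronwall (E : R -> R) (alpha c b : R) : 0 < alpha -> 0 <= c -> 0 < b ->
  {within `[0, b], continuous E} ->
  (forall t, 0 < t < b -> derivable E t 1) ->
  (forall t, 0 < t < b -> derive1 E t <= - alpha * E t + c) ->
  E b <= expR (- alpha * b) * E 0 + c / alpha.
Proof.
move=> a0 c0 b0 cE dE E'.
pose W t := expR (alpha * t) * (E t - c / alpha).
have dexp (t : R) : is_derive t (1 : R) (fun t : R => expR (alpha * t))
    (alpha * expR (alpha * t)).
  rewrite mulrC.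
  apply: (@is_derive1_comp _ expR (fun t : R => alpha * t)).
  by rewrite -[X in is_derive _ _ _ X]mulr1; exact: is_deriveZ.
have dW (t : R) : 0 < t < b -> is_derive t (1 : R) W
    (expR (alpha * t) * derive1 E t + alpha * expR (alpha * t) * (E t - c / alpha)).
  move=> tb; have dEt := DeriveDef (dE t tb) (esym (derive1E _ _)).
  have dEc : is_derive t (1 : R) (fun t : R => E t - c / alpha) (derive1 E t).
    rewrite -[X in is_derive _ _ _ X]subr0; exact: is_deriveB.
  have := @is_deriveM _ _ _ _ _ _ _ _ (dexp t) dEc.
  by rewrite /GRing.scale/= (mulrC (E t - _)).
have cW : {within `[0, b], continuous W}.
  have c1 : {within `[0, b], continuous (fun t => expR (alpha * t))}.
    apply: continuous_subspaceT => t.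
    by apply: differentiable_continuous; apply/derivable1_diffP; case: (dexp t).
  have c2 : {within `[0, b], continuous (fun t => E t - c / alpha)}.
    by move=> t; apply: (@continuousB _ _ (subspace `[0, b]) E (fun=> c / alpha));
      [exact: cE|exact: cst_continuous].
  by move=> t; apply: (@continuousM _ (subspace `[0, b])
    (fun t => expR (alpha * t)) (fun t => E t - c / alpha)); [exact: c1|exact: c2].
have := @ler0_derive1_le_cc R W 0 b.
move=> W0b.
have {W0b} : W b <= W 0.
  apply: W0b => //; rewrite ?in_itv/= ?lexx ?(ltW b0)// => t; rewrite in_itv/= => tb.
    by case: (dW t tb).
  rewrite derive1E (derive_val (is_derive := dW t tb)).
  have := E' t tb; have := expR_gt0 (alpha * t).
  set x := expR _; move=> x0 h.
  have -> : x * derive1 E t + alpha * x * (E t - c / alpha) =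
    x * (derive1 E t + alpha * E t - c) by field; rewrite gt_eqF.
  by rewrite pmulr_rle0//; lra.
rewrite /W mulr0 expR0 mul1r mulrC -ler_pdivlMr ?expR_gt0// -expRN.
move=> h; have h2 : (E 0 - c / alpha) * expR (- alpha * b) <= expR (- alpha * b) * E 0.
  rewrite mulrC ler_wpM2l ?expR_ge0// gerBl divr_ge0// ltW//.
by rewrite -lerBlDr; apply: (le_trans _ h2); rewrite [- alpha * b]mulNr.
Qed.

End Gronwall.

Lemma within_continuous_comp (X Y Z : topologicalType) (A : set Y) (f : Y -> Z)
    (g : X -> Y) : {within A, continuous f} -> continuous g ->
  (forall x, A (g x)) -> continuous (f \o g).
Proof.
move=> /subspace_continuousP cf cg Ag x P fP.
have := cg x _ (cf _ (Ag x) _ fP); rewrite /nbhs/=.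
by apply: filterS => y /(_ (Ag y)).
Qed.

Lemma continuous_pair_at (X Y Z : topologicalType) (f : X -> Y) (g : X -> Z) x :
  {for x, continuous f} -> {for x, continuous g} ->
  {for x, continuous (fun y => (f y, g y))}.
Proof. by move=> cf cg; exact: (cvg_pair cf cg). Qed.

Lemma continuous_pairr (X Y : topologicalType) (y : Y) :
  continuous (fun x : X => (y, x)).
Proof.
by move=> x; apply: (continuous_pair_at (f := fun=> y) (g := id));
  [exact: cst_continuous|exact: cvg_id].
Qed.

Lemma continuous_pairl (X Y : topologicalType) (y : Y) :
  continuous (fun x : X => (x, y)).
Proof.
by move=> x; apply: (continuous_pair_at (f := id) (g := fun=> y));
  [exact: cvg_id|exact: cst_continuous].
Qed.

Section EnergyEvolution.
Context {R : realType} {d : nat}.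
Local Notation T := (torus R d).

(** Compactness of [[a, b]] times the torus. It supplies the constants that dominate the integrands
    when passing to the limit under the integral. *)
Lemma strip_bounded (g : R * T -> R) (a b : R) : a <= b ->
  (forall p, a <= p.1 <= b -> {for p, continuous g}) ->
  exists M, forall t x, a <= t <= b -> `|g (t, x)| <= M.
Proof.
move=> ab cg.
have [||c _ gc] := @compact_EVT_max _ _ (fun p => `|g p|) _ _
    (compact_setX (@segment_compact R a b) (@compact_torus R d)).
- by exists (a, 0); split; rewrite //= in_itv/= lexx.
- apply: continuous_in_subspaceT => p; rewrite inE => -[/= pab _].
  apply: continuous_comp; last exact: norm_continuous.
  by apply: cg; rewrite in_itv/= in pab.
- by exists `|g c| => t x tab; apply: gc; rewrite inE; split.
Qed.

Variable u : R -> T -> R.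
Hypothesis cu : {within [set p : R * T | 0 <= p.1],
  continuous (fun p : R * T => u p.1 p.2)}.

(** Freezing [u] at its initial value for negative times makes it continuous everywhere, so time 0
    becomes interior to an open interval. *)
Let U (p : R * T) := u (Num.max p.1 0) p.2.

Let cU : continuous U.
Proof.
apply: (within_continuous_comp cu (g := fun p : R * T => (Num.max p.1 0, p.2))).
  move=> p.
  have c1 : {for p, continuous (fun p : R * T => Num.max p.1 0)}.
    by apply: (@continuous_max _ _ fst (cst 0)); [exact: cvg_fst|exact: cst_continuous].
  have c2 : {for p, continuous (fun p : R * T => p.2)} by exact: cvg_snd.
  exact: (continuous_pair_at c1 c2).
by move=> p; rewrite /= le_max lexx orbT.
Qed.

Lemma continuous_slice t : 0 <= t -> continuous (u t).
Proof.
move=> t0; apply: (within_continuous_comp cu (g := fun x : T => (t, x))) => //.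
exact: continuous_pairr.
Qed.

Lemma continuous_energy b : 0 < b ->
  {within `[0, b], continuous (fun t => \int[haar]_x u t x ^+ 2)}.
Proof.
move=> b0; pose f t x := U (t, x) ^+ 2.
have cUt t : continuous (fun x => U (t, x)).
  move=> x; apply: continuous_comp; last exact: cU.
  exact: continuous_pairr.
have cUx x : continuous (fun t => U (t, x)).
  move=> t; apply: continuous_comp; last exact: cU.
  exact: continuous_pairl.
have [|M UM] := @strip_bounded U (-1) (b + 1) _ (fun p _ => cU (x := p)).
  lra.
have c : {in `](-1), (b + 1)[%classic, continuous (fun t => \int[haar]_x f t x)}.
  apply: (@continuity_under_integral _ _ _ haar f setT measurableT (-1) (b + 1)
    _ _ (cst (M ^+ 2))).
  - by move=> t _; apply: continuous_integrable_torus; exact: continuousX2.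
  - apply: aeW => x _ t _.
    exact: (continuousX2 (cUx x)).
  - by apply: continuous_integrable_torus; exact: cst_continuous.
  - move=> t; rewrite /= in_itv/= => /andP[t1 t2]; apply: aeW => x _.
    rewrite /f normrX ler_pXn2r// ?nnegrE.
      by apply: UM; rewrite !ltW.
    by apply: le_trans (UM t x _); rewrite ?normr_ge0// !ltW.
have : {within `[0, b], continuous (fun t => \int[haar]_x f t x)}.
  apply: continuous_in_subspaceT => t; rewrite inE/= in_itv/= => /andP[t0 tb].
  by apply: c; rewrite inE/= in_itv/=; apply/andP; split; lra.
apply: subspace_eq_continuous => t; rewrite inE/= in_itv/= => /andP[t0 _].
by apply: eq_Rintegral => x _; rewrite /f /U/= max_l.
Qed.

Variable u' : R -> T -> R.
Hypothesis du : forall (t : R) (x : T), 0 < t ->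
  is_derive t (1 : R) (fun s => u s x) (u' t x).
Hypothesis cdu : forall p : R * T, 0 < p.1 ->
  {for p, continuous (fun p : R * T => u' p.1 p.2)}.

Lemma continuous_derivative_slice t : 0 < t -> continuous (u' t).
Proof.
move=> t0 x; apply: (@continuous_comp _ _ _ (fun x : T => (t, x))
  (fun p : R * T => u' p.1 p.2)).
  exact: continuous_pairr.
exact: cdu.
Qed.

(** Differentiation under the integral on []t / 2, 2 t[]: the time derivative is controlled only
    away from 0, and there it is bounded on a compact strip. *)
Lemma is_derive_energy (t : R) : 0 < t ->
  is_derive t (1 : R) (fun t => \int[haar]_x u t x ^+ 2)
    (2 * \int[haar]_x (u t x * u' t x)).
Proof.
move=> t0; pose f t x := u t x ^+ 2.
have [|p|M UM] := @strip_bounded U (t / 2) (t * 2); first lra.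
  by move=> _; exact: cU.
have [|p|N dN] := @strip_bounded (fun p => u' p.1 p.2) (t / 2) (t * 2).
    lra.
  by move=> /andP[tp _]; apply: cdu; lra.
have df (s : R) x : 0 < s -> is_derive s (1 : R) (fun s => f s x) (2 * (u s x * u' s x)).
  move=> s0; rewrite /f; under eq_fun do rewrite expr2.
  have dus := @du s x s0.
  have := @is_deriveM _ _ _ _ _ _ _ _ dus dus.
  by rewrite /GRing.scale/= mulr_natl mulr2n.
have I t' : `](t / 2), (t * 2)[%classic t' -> 0 < t' /\ t / 2 <= t' <= t * 2.
  rewrite /= in_itv/= => /andP[h1 h2]; split; first lra.
  by rewrite !ltW.
have intf s : `](t / 2), (t * 2)[%classic s -> haar.-integrable setT (EFin \o f s).
  move=> /I[s0 _]; apply: continuous_integrable_torus.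
  by apply: continuousX2; apply: continuous_slice; exact: ltW.
have It : `](t / 2), (t * 2)[%classic t by rewrite /= in_itv/=; lra.
have derf s x : `](t / 2), (t * 2)[%classic s -> [set: T] x -> derivable (f ^~ x) s 1.
  by move=> /I[s0 _] _; case: (df s x s0).
have Gint : haar.-integrable [set: T] (EFin \o cst (2 * (`|M| * `|N|))).
  by apply: continuous_integrable_torus; exact: cst_continuous.
have Gub s x : `](t / 2), (t * 2)[%classic s -> [set: T] x ->
    `|partial1of2 f s x| <= cst (2 * (`|M| * `|N|)) x.
  move=> /I[s0 sI] _; rewrite /partial1of2 derive1E (derive_val (is_derive := df s x s0)).
  rewrite normrM ger0_norm// ler_wpM2l// normrM ler_pM//.
    apply: le_trans (ler_norm _); have := UM s x sI.
    by rewrite /U/= max_l// ltW.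
  by apply: le_trans (ler_norm _); exact: dN.
have G0 : forall y : T, 0 <= cst (2 * (`|M| * `|N|)) y.
  by move=> y; rewrite /= !mulr_ge0.
apply: DeriveDef.
  exact: (derivable_under_integral measurableT It intf derf G0 Gint Gub).
rewrite -derive1E (differentiation_under_integral measurableT It intf derf G0 Gint Gub).
rewrite -RintegralZ_torus; last first.
  move=> x; apply: continuousM; last exact: continuous_derivative_slice.
  by apply: continuous_slice; exact: ltW.
apply: eq_Rintegral => x _.
by rewrite /partial1of2 derive1E (derive_val (is_derive := df t x t0)).
Qed.

End EnergyEvolution.

(** * The dissipation inequality *)

Section FieldCalculus.
Context {R : realType} {d : nat}.
Local Notation T := (torus R d).
Implicit Types F G : T -> 'cV[R]_d.

Lemma C1_fieldD F G : C1_field F -> C1_field G -> C1_field (fun x => F x + G x).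
Proof.
by move=> cF cG i; under eq_fun do rewrite mxE; exact: C1_add.
Qed.

Lemma C1_fieldZ (c : R) F : C1_field F -> C1_field (fun x => c *: F x).
Proof. by move=> cF i; under eq_fun do rewrite mxE; exact: C1_scale. Qed.

Lemma divergenceD F G x : C1_field F -> C1_field G ->
  divergence (fun x => F x + G x) x = divergence F x + divergence G x.
Proof.
move=> cF cG; rewrite /divergence -big_split; apply: eq_bigr => i _ /=.
under eq_fun do rewrite mxE.
by rewrite pderivD//; [case: (cF i)|case: (cG i)].
Qed.

Lemma divergenceZ (c : R) F x : C1_field F ->
  divergence (fun x => c *: F x) x = c * divergence F x.
Proof.
move=> cF; rewrite /divergence mulr_sumr; apply: eq_bigr => i _ /=.
under eq_fun do rewrite mxE.
by rewrite pderivZ//; case: (cF i).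
Qed.

Lemma C1_field_continuous F i : C1_field F -> continuous (fun x => F x i 0).
Proof. by move=> cF; case: (cF i). Qed.

Lemma gradB (f g : T -> R) x : C1 f -> C1 g ->
  grad (fun x => f x - g x) x = grad f x - grad g x.
Proof.
move=> [_ df _] [_ dg _]; apply/colP => i; rewrite !mxE /pderiv !derive1E.
by rewrite -deriveB.
Qed.

Lemma continuous_grad (f : T -> R) i : C1 f -> continuous (fun x => grad f x i 0).
Proof. by case=> _ _ cf; under eq_fun do rewrite mxE; exact: cf. Qed.

Lemma C1_sub (f g : T -> R) : C1 f -> C1 g -> C1 (fun x => f x - g x).
Proof.
move=> cf cg; have := C1_add cf (C1_scale (-1) cg).
by under eq_fun do rewrite mulN1r.
Qed.

End FieldCalculus.

Section Dissipation.
Context {R : realType}.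

(* Young's inequality is used twice with weight [kappa / 4]; half of the nudging
   dissipation absorbs the smoothing error. *)
Lemma young_poincare (kappa lambda nulow CP B Lmu rhobar delta D p q w s : R) :
  0 < kappa -> 0 < lambda -> 0 < nulow -> 0 < CP -> 0 < rhobar -> 0 <= p ->
  w <= Lmu * q -> s <= delta * p -> delta <= nulow / (2 * rhobar) ->
  q ^+ 2 <= CP * p ^+ 2 ->
  B * (p * q) + rhobar * (p * w) + rhobar * D * p
    - (kappa + lambda * nulow) * p ^+ 2 + lambda * rhobar * (p * s) <=
  - (((kappa + lambda * nulow) / CP - 2 * (B + rhobar * Lmu) ^+ 2 / kappa) / 2)
    * q ^+ 2 + rhobar ^+ 2 * D ^+ 2 / kappa.
Proof.
move=> k0 l0 n0 C0 r0 p0 wq sp dl qp; set C := B + rhobar * Lmu.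
have h1 : rhobar * (p * w) <= rhobar * (p * (Lmu * q)).
  by rewrite ler_pM2l// ler_wpM2l.
have h2 : lambda * rhobar * (p * s) <= lambda * nulow / 2 * p ^+ 2.
  apply: (@le_trans _ _ (lambda * rhobar * (p * (nulow / (2 * rhobar) * p)))).
    rewrite ler_pM2l ?mulr_gt0// ler_wpM2l//; apply: (le_trans sp).
    by rewrite ler_wpM2r.
  by rewrite le_eqVlt; apply/orP; left; apply/eqP; field; rewrite gt_eqF.
have h3 : C * (p * q) <= kappa / 4 * p ^+ 2 + C ^+ 2 / kappa * q ^+ 2.
  rewrite -subr_ge0.
  have -> : kappa / 4 * p ^+ 2 + C ^+ 2 / kappa * q ^+ 2 - C * (p * q) =
    (kappa * p / 2 - C * q) ^+ 2 / kappa by field; rewrite gt_eqF.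
  by rewrite divr_ge0 ?sqr_ge0// ltW.
have h4 : rhobar * D * p <= kappa / 4 * p ^+ 2 + rhobar ^+ 2 * D ^+ 2 / kappa.
  rewrite -subr_ge0.
  have -> : kappa / 4 * p ^+ 2 + rhobar ^+ 2 * D ^+ 2 / kappa - rhobar * D * p =
    (kappa * p / 2 - rhobar * D) ^+ 2 / kappa by field; rewrite gt_eqF.
  by rewrite divr_ge0 ?sqr_ge0// ltW.
(* The half of the dissipation not consumed by [h2], [h3] and [h4] is converted by Poincare. *)
have h5 : (kappa + lambda * nulow) / CP / 2 * q ^+ 2 <=
    (kappa + lambda * nulow) / 2 * p ^+ 2.
  have -> : (kappa + lambda * nulow) / 2 * p ^+ 2 =
    (kappa + lambda * nulow) / CP / 2 * (CP * p ^+ 2) by field; rewrite gt_eqF.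
  by rewrite ler_wpM2l// !divr_ge0 ?(ltW C0)// addr_ge0 ?(ltW k0)// mulr_ge0// ltW.
have -> : - (((kappa + lambda * nulow) / CP - 2 * C ^+ 2 / kappa) / 2) * q ^+ 2 =
  - ((kappa + lambda * nulow) / CP / 2 * q ^+ 2) + C ^+ 2 / kappa * q ^+ 2.
  by field; rewrite !gt_eqF.
have h6 : B * (p * q) + rhobar * (p * (Lmu * q)) = C * (p * q) by rewrite /C; ring.
lra.
Qed.

End Dissipation.

Section EnergyDissipation.
Context {R : realType} {d : nat}.
Local Notation T := (torus R d).

(** The shape [a * f + g] lets repeated rewriting peel a nested linear combination term by term. *)
Lemma weighted_integral_lin (P f g : T -> R) (a : R) :
  continuous P -> continuous f -> continuous g ->
  \int[haar]_x (P x * (a * f x + g x)) =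
  a * \int[haar]_x (P x * f x) + \int[haar]_x (P x * g x).
Proof.
move=> cP cf cg.
have cPf : continuous (fun x => P x * f x).
  by move=> x; apply: continuousM; [exact: cP|exact: cf].
have cPg : continuous (fun x => P x * g x).
  by move=> x; apply: continuousM; [exact: cP|exact: cg].
rewrite -RintegralZ_torus// -RintegralD_torus//.
  by apply: eq_Rintegral => x _; ring.
by move=> x; apply: (@continuousM _ _ (fun=> a) (fun x => P x * f x));
  [exact: cst_continuous|exact: cPf].
Qed.

Lemma continuous_lin (f g : T -> R) (a : R) : continuous f -> continuous g ->
  continuous (fun x => a * f x + g x).
Proof.
move=> cf cg x; apply: (@continuousD _ _ _ (fun x => a * f x) g); last exact: cg.
by apply: (@continuousM _ _ (fun=> a) f); [exact: cst_continuous|exact: cf].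
Qed.

Variables (A : 'M[R]_d) (kappa : R).
Variables (b_true b_model : T -> probability T R -> 'cV[R]_d).
Variables (k : T -> R) (lambda : R) (u v : density R d).
Variables (Bmodel Lmodel Lmu rhobar nulow delta CP D : R).

Let e (x : T) : R := v x - u x.
Let Ktilde : T -> R := convolution k k.
Let g (x : T) : 'cV[R]_d := grad (convolution Ktilde e) x.
Let Ft := transport_flux b_true u.
Let Fm := transport_flux b_model v.
Let Nf := nudging_flux k u v.

Hypothesis sA : A^T = A.
Hypothesis hkappa : smallest_eigenvalue A kappa.
Hypothesis kappa_gt0 : 0 < kappa.
Hypothesis lambda_gt0 : 0 < lambda.
Hypothesis hk : smoothing_kernel k.
Hypothesis (C1u : C1 u) (C1v : C1 v).
Hypothesis (C1Ft : C1_field Ft) (C1Fm : C1_field Fm) (C1Nf : C1_field Nf).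
Hypothesis (C1Du : C1_field (diffusion_flux A u)) (C1Dv : C1_field (diffusion_flux A v)).
Hypothesis hbounded : bounded_drift b_model Bmodel.
Hypothesis hlip : lipschitz_drift b_model Lmodel.
Hypothesis hlip2 : L2_lipschitz_drift b_model Lmu.
Hypothesis uup : (Linfty_norm u <= rhobar%:E)%E.
Hypothesis vup : (Linfty_norm v <= rhobar%:E)%E.
Hypothesis nulow_gt0 : 0 < nulow.
Hypothesis vlow : forall x, nulow <= v x.
Hypothesis happrox : (L2norm_field (fun x => (grad e x - g x)%R) <=
  delta%:E * L2norm_field (grad e))%E.
Hypothesis hCP : poincare_constant d CP.
Hypothesis hdelta : delta <= nulow / (2 * rhobar).
Hypothesis hD : (Linfty_norm_field (fun x =>
  (b_model x (density_prob u) - b_true x (density_prob u))%R) <= D%:E)%E.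

(** Linearity and associativity of convolution: smoothing the residual once more is smoothing the
    error by [Ktilde], the field compared with [grad e] in [happrox]. *)
Lemma nudging_fluxE x : Nf x = v x *: g x.
Proof.
have [cu _ _] := C1u; have [cv _ _] := C1v.
have conv_r : convolution k (fun y => convolution k v y - convolution k u y) =
    convolution Ktilde e.
  rewrite (convolutionB hk cv cu) (convolutionA hk)// => y.
  by apply: continuousB; [exact: cv|exact: cu].
by rewrite /Nf /nudging_flux conv_r.
Qed.

Let w x := b_model x (density_prob v) - b_model x (density_prob u).
Let z x := b_model x (density_prob u) - b_true x (density_prob u).

Let C1e : C1 e. Proof. exact: C1_sub. Qed.

Let cp i : continuous (fun x => grad e x i 0). Proof. exact: continuous_grad. Qed.

(** An integrable kernel gives no such regularity by itself; it comes from the [C1] nudging flux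
    divided by [v], which stays above [nulow]. *)
Let cg i : continuous (fun x => g x i 0).
Proof.
have -> : (fun x => g x i 0) = fun x => (v x)^-1 * Nf x i 0.
  apply/funext => x; rewrite nudging_fluxE [X in _ * X]mxE mulKf// gt_eqF//.
  exact: lt_le_trans (vlow x).
move=> x; apply: (@continuousM _ _ (fun x => (v x)^-1) (fun x => Nf x i 0)).
  2: exact: C1_field_continuous.
apply: continuousV; last by have [cv _ _] := C1v; exact: cv.
by rewrite gt_eqF//; exact: lt_le_trans (vlow x).
Qed.

Let cpn : continuous (fun x => enorm (grad e x)).
Proof. exact: continuous_enorm_field. Qed.

Let cpg : continuous (fun x => enorm (grad e x - g x)).
Proof.
apply: continuous_enorm_field => i; under eq_fun do rewrite mxE [X in _ + X]mxE.
by move=> x; apply: continuousB; [exact: cp|exact: cg].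
Qed.

Let cw : continuous (fun x => enorm (w x)).
Proof.
apply: continuous_enorm_field => i; under eq_fun do rewrite mxE [X in _ + X]mxE.
move=> x; apply: continuousB.
  exact: (@continuous_lipschitz_drift _ _ _ _ (density_prob v) i hlip).
exact: (@continuous_lipschitz_drift _ _ _ _ (density_prob u) i hlip).
Qed.

Let ce : continuous e. Proof. by case: C1e. Qed.

Let cen : continuous (fun x => `|e x|).
Proof. by move=> x; apply: continuous_comp; [exact: ce|exact: norm_continuous]. Qed.

Let G x := (-1) *: Fm x + diffusion_flux A v x + lambda *: Nf x +
  (Ft x + (-1) *: diffusion_flux A u x).

Let C1G : C1_field G.
Proof.
exact: (C1_fieldD (C1_fieldD (C1_fieldD (C1_fieldZ _ C1Fm) C1Dv) (C1_fieldZ _ C1Nf))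
  (C1_fieldD C1Ft (C1_fieldZ _ C1Du))).
Qed.

Let divG x : divergence G x =
  - divergence Fm x + divergence (diffusion_flux A v) x + lambda * divergence Nf x
  - (- divergence Ft x + divergence (diffusion_flux A u) x).
Proof.
have c1 := C1_fieldZ (-1) C1Fm; have c2 := C1_fieldZ (-1) C1Du.
have c3 := C1_fieldZ lambda C1Nf.
rewrite -[LHS]/(divergence (fun x => (-1) *: Fm x + diffusion_flux A v x +
  lambda *: Nf x + (Ft x + (-1) *: diffusion_flux A u x)) x).
rewrite (divergenceD x (C1_fieldD (C1_fieldD c1 C1Dv) c3) (C1_fieldD C1Ft c2)).
rewrite (divergenceD x (C1_fieldD c1 C1Dv) c3) (divergenceD x c1 C1Dv).
rewrite (divergenceD x C1Ft c2) (divergenceZ _ x C1Fm) (divergenceZ _ x C1Du).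
rewrite (divergenceZ _ x C1Nf) !mulN1r; congr (_ + _).
by rewrite opprD opprK.
Qed.

(* [v b_model(v) - u b_true(u)] is split as [e b_model(v) + u w + u z]. *)
Let fluxE x : - (\sum_i pderiv i e x * G x i 0) =
  e x * (\sum_i grad e x i 0 * b_model x (density_prob v) i 0) +
  u x * (\sum_i grad e x i 0 * w x i 0) +
  u x * (\sum_i grad e x i 0 * z x i 0) -
  \sum_i grad e x i 0 * (A *m grad e x) i 0 -
  lambda * v x * enorm (grad e x) ^+ 2 +
  lambda * v x * (\sum_i grad e x i 0 * (grad e x - g x) i 0).
Proof.
have -> : A *m grad e x = diffusion_flux A v x - diffusion_flux A u x.
  by rewrite [grad e x]gradB// mulmxBr.
rewrite enorm_sqr !mulr_sumr -!sumrN -!big_split/=.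
apply: eq_bigr => i _; have -> : pderiv i e x = grad e x i 0 by rewrite mxE.
rewrite /G nudging_fluxE /Fm /Ft /transport_flux /w /z.
move: (grad e x) (g x) (diffusion_flux A v x) (diffusion_flux A u x).
by move=> p gx dv du; rewrite !mxE /e; ring.
Qed.

Lemma energy_dissipation :
  \int[haar]_x (e x *
    (- divergence Fm x + divergence (diffusion_flux A v) x + lambda * divergence Nf x
     - (- divergence Ft x + divergence (diffusion_flux A u) x))) <=
  - (((kappa + lambda * nulow) / CP - 2 * (Bmodel + rhobar * Lmu) ^+ 2 / kappa) / 2)
    * (\int[haar]_x e x ^+ 2) + rhobar ^+ 2 * D ^+ 2 / kappa.
Proof.
have [cu _ _] := C1u; have [cv _ _] := C1v.
have rho0 : 0 < rhobar by exact: lt_le_trans (Linfty_norm_density_ge1 cu uup).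
under eq_Rintegral do rewrite -divG.
rewrite integral_by_parts//.
set P := fun x => enorm (grad e x).
pose p := L2n P; pose q := L2n (fun x => `|e x|).
pose nw := L2n (fun x => enorm (w x)).
pose s := L2n (fun x => enorm (grad e x - g x)).
have q2 : \int[haar]_x e x ^+ 2 = q ^+ 2.
  by rewrite L2n_sqr; apply: eq_Rintegral => x _; rewrite real_normK ?num_real.
have L2e : L2norm e = q%:E.
  by rewrite L2normE// /L2n; congr (Num.sqrt _)%:E; rewrite q2 L2n_sqr.
rewrite q2; apply: le_trans (@young_poincare _ kappa lambda nulow CP Bmodel Lmu
    rhobar delta D p q nw s _ _ _ _ _ _ _ _ _ _) => //; last first.
(* Poincare requires zero mean, which holds because both densities have mass 1. *)
- have [_ /(_ e C1e)] := hCP.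
  rewrite L2e L2norm_fieldE// -/p -!EFin_expe -EFinM lee_fin; apply.
  by rewrite RintegralB_torus// !Rintegral_density subrr.
- by move: happrox; rewrite !L2norm_fieldE// -EFinM lee_fin.
- by have := hlip2 v u; rewrite L2norm_fieldE// [L2norm _]L2e -EFinM lee_fin.
- exact: L2n_ge0.
- by case: hCP.
(* Every term of the flux carries a factor [P = enorm (grad e)]. [S5] bounds what remains after
   taking it out, nested in the form that [weighted_integral_lin] peels; the final [+ 0] closes the
   nesting. *)
pose S1 x := lambda * rhobar * enorm (grad e x - g x) + 0.
pose S2 x := - (kappa + lambda * nulow) * P x + S1 x.
pose S3 x := rhobar * D * 1 + S2 x.
pose S4 x := rhobar * enorm (w x) + S3 x.
pose S5 x := Bmodel * `|e x| + S4 x.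
have c0 : continuous (fun _ : T => 0 : R) by exact: cst_continuous.
have c1' : continuous (fun _ : T => 1 : R) by exact: cst_continuous.
have c1 : continuous S1 by exact: continuous_lin.
have c2 : continuous S2 by exact: continuous_lin.
have c3 : continuous S3 by exact: (continuous_lin (f := fun=> 1)).
have c4 : continuous S4 by exact: continuous_lin.
have c5 : continuous S5 by exact: continuous_lin.
have B0 : 0 <= Bmodel.
  have [bB _] := hbounded (finite_second_momentT (density_prob v)).
  by rewrite -lee_fin; apply: le_trans bB; exact: Lnorm_ge0.
have D0 : 0 <= D by rewrite -lee_fin; apply: le_trans hD; exact: Lnorm_ge0.
apply: (@le_trans _ _ (\int[haar]_x (P x * S5 x))).
  have cS : continuous (fun x => \sum_i pderiv i e x * G x i 0).
    apply: (@continuous_sumr _ _ _ _ (fun i x => pderiv i e x * G x i 0)) => i x.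
    apply: continuousM; last exact: C1_field_continuous.
    by have [_ _ cde] := C1e; exact: cde.
  rewrite -[leLHS]mulN1r -RintegralZ_torus//; apply: ae_le_Rintegral.
  - move=> x; apply: (@continuousM _ _ (fun=> -1)
      (fun x => \sum_i pderiv i e x * G x i 0)); last exact: cS.
    exact: cst_continuous.
  - by move=> x; apply: continuousM; [exact: cpn|exact: c5].
  have [bB _] := hbounded (finite_second_momentT (density_prob v)).
  have hB := Linfty_norm_ae bB; have hu := Linfty_norm_ae uup.
  have hz := Linfty_norm_ae hD.
  have hv := Linfty_norm_ae vup.
  apply: filterS3 (filterI hu hv) hB hz => x [].
  rewrite !lee_fin !(ger0_norm (enorm_ge0 _)) !(ger0_norm (density_ge0 _ _)).
  move=> xu xv xB xz.
  rewrite mulN1r fluxE.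
  have u0 := density_ge0 u x.
  have v0 : 0 <= v x by apply: le_trans (vlow x); exact: ltW.
  have P0 : 0 <= P x by exact: enorm_ge0.
  have t1 : e x * (\sum_i grad e x i 0 * b_model x (density_prob v) i 0) <=
      P x * (Bmodel * `|e x|).
    apply: (@le_trans _ _ (`|e x| * (P x * Bmodel))); last first.
      by rewrite le_eqVlt; apply/orP; left; apply/eqP; ring.
    apply: le_trans (ler_norm _) _; rewrite normrM ler_wpM2l//.
    by apply: le_trans (cauchy_schwarz_enorm _ _) _; rewrite ler_wpM2l.
  have t2 : u x * (\sum_i grad e x i 0 * w x i 0) <= P x * (rhobar * enorm (w x)).
    apply: (@le_trans _ _ (u x * (P x * enorm (w x)))).
      rewrite ler_wpM2l//; apply: le_trans (ler_norm _) _.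
      exact: cauchy_schwarz_enorm.
    by rewrite mulrCA ler_wpM2l// ler_wpM2r// enorm_ge0.
  (* [b_true] comes without a regularity assumption in space, so [z] is replaced by its essential
     bound before integrating. *)
  have t3 : u x * (\sum_i grad e x i 0 * z x i 0) <= P x * (rhobar * D).
    apply: (@le_trans _ _ (u x * (P x * enorm (z x)))).
      rewrite ler_wpM2l//; apply: le_trans (ler_norm _) _.
      exact: cauchy_schwarz_enorm.
    by rewrite mulrCA ler_wpM2l// ler_pM// enorm_ge0.
  have t4 : kappa * P x ^+ 2 <= \sum_i grad e x i 0 * (A *m grad e x) i 0.
    exact: smallest_eigenvalue_le.
  have t5 : lambda * nulow * P x ^+ 2 <= lambda * v x * P x ^+ 2.
    by rewrite ler_wpM2r ?sqr_ge0// ler_pM2l.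
  have t6 : lambda * v x * (\sum_i grad e x i 0 * (grad e x - g x) i 0) <=
      P x * (lambda * rhobar * enorm (grad e x - g x)).
    apply: (@le_trans _ _ (lambda * v x * (P x * enorm (grad e x - g x)))).
      rewrite ler_wpM2l ?mulr_ge0 ?(ltW lambda_gt0)//; apply: le_trans (ler_norm _) _.
      exact: cauchy_schwarz_enorm.
    by rewrite mulrCA ler_wpM2l// ler_wpM2r ?enorm_ge0// ler_pM2l.
  have -> : P x * S5 x = P x * (Bmodel * `|e x|) + P x * (rhobar * enorm (w x)) +
    P x * (rhobar * D) - (kappa * P x ^+ 2 + lambda * nulow * P x ^+ 2) +
    P x * (lambda * rhobar * enorm (grad e x - g x)).
    by rewrite /S5/S4/S3/S2/S1; ring.
  by rewrite -/(P x) opprD !addrA; do !(apply: lerD => //); rewrite lerN2.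
rewrite !weighted_integral_lin//.
have i1 := cauchy_schwarz_torus cpn cen.
have i2 := cauchy_schwarz_torus cpn cw.
have i3 := cauchy_schwarz_torus cpn c1'.
have i4 : \int[haar]_x (P x * P x) = p ^+ 2.
  by rewrite L2n_sqr; apply: eq_Rintegral => x _; rewrite expr2.
have i5 := cauchy_schwarz_torus cpn cpg.
(* Cauchy-Schwarz against 1 bounds the integral of [P] by [p], as the torus has measure 1. *)
have n1 : L2n (fun _ : T => 1 : R) = 1.
  rewrite /L2n; under eq_Rintegral do rewrite expr1n.
  rewrite Rintegral_cst// mul1r [X in fine X](@probability_setT _ _ _ haar).
  by rewrite sqrtr1.
rewrite n1 mulr1 -/p in i3; rewrite -/p -/q in i1; rewrite -/p -/nw in i2.
rewrite -/p -/s in i5; rewrite i4.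
have z0 : \int[haar]_x (P x * 0) = 0.
  by under eq_Rintegral do rewrite mulr0; rewrite Rintegral_cst// mul0r.
rewrite z0.
have j1 := ler_wpM2l B0 i1.
have j2 := ler_wpM2l (ltW rho0) i2.
have j3 := ler_wpM2l (mulr_ge0 (ltW rho0) D0) i3.
have j5 := ler_wpM2l (mulr_ge0 (ltW lambda_gt0) (ltW rho0)) i5.
rewrite addr0 !addrA mulNr.
exact: (lerD (lerD (lerD (lerD j1 j2) j3) (lexx _)) j5).
Qed.

End EnergyDissipation.

(** * Exponential decay *)

Section Slices.
Context {R : realType} {d : nat}.
Local Notation T := (torus R d).

Lemma C12_C1 (w : R -> T -> R) t : C12 w -> 0 < t -> C1 (w t).
Proof.
move=> cw t0; split=> [|i x|i x].
- by apply: (continuous_slice (C12_cont cw)); exact: ltW.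
- exact: (C12_dx cw).
- apply: (@continuous_comp _ _ _ (fun x : T => (t, x))
    (fun p : R * T => pderiv i (w p.1) p.2)); first exact: continuous_pairr.
  exact: (C12_dx_cont cw).
Qed.

Lemma C12_C1_pderiv (w : R -> T -> R) t j : C12 w -> 0 < t -> C1 (pderiv j (w t)).
Proof.
move=> cw t0; split=> [|i x|i x].
- by case: (C12_C1 cw t0).
- exact: (C12_dxx cw).
- apply: (@continuous_comp _ _ _ (fun x : T => (t, x))
    (fun p : R * T => pderiv i (pderiv j (w p.1)) p.2)); first exact: continuous_pairr.
  exact: (C12_dxx_cont cw).
Qed.

Lemma C1_diffusion_flux (A : 'M[R]_d) (w : R -> density R d) t :
  C12 (fun t => w t) -> 0 < t -> C1_field (diffusion_flux A (w t)).
Proof.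
move=> cw t0 i.
have -> : (fun x => diffusion_flux A (w t) x i 0) =
    fun x => \sum_j A i j * pderiv j (w t) x.
  by apply/funext => x; rewrite mxE; apply: eq_bigr => j _; rewrite mxE.
by apply: C1_sum => j; apply: C1_scale; exact: (C12_C1_pderiv _ cw).
Qed.

Lemma expR_decay (alpha c : R) : 0 < alpha ->
  expR (- alpha * t) * c @[t --> +oo] --> 0.
Proof.
move=> a0; rewrite -[X in _ --> X](mul0r c); apply: cvgMl.
under eq_fun do rewrite mulNr.
apply: (@cvg_comp _ _ _ (fun t => alpha * t) (fun t => expR (- t)) _ +oo%R).
  by apply: gt0_cvgMry => //; exact: cvg_id.
exact: cvgr_expR.
Qed.

(** For each positive [e], the nonnegative times with [g] within [e] of 0 form a neighbourhood of
    infinity, on which the supremum of [f] is at most [c + e]. *)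
Lemma limf_esup_le_eventually (f : R -> \bar R) (g : R -> R) (c : R) :
  (forall t, 0 <= t -> (f t <= (g t + c)%:E)%E) -> g t @[t --> +oo] --> 0 ->
  (limf_esup f (pinfty_nbhs R) <= c%:E)%E.
Proof.
move=> fg g0; apply/lee_addgt0Pr => e e0.
have /cvgrPdist_le/(_ _ e0) gle := g0.
have nA : pinfty_nbhs R [set t | 0 <= t /\ `|0 - g t| <= e].
  by apply: filterI => //; exact: nbhs_pinfty_ge.
apply: (@le_trans _ _ (ereal_sup (f @` [set t | 0 <= t /\ `|0 - g t| <= e]))).
  by apply: ereal_inf_lbound; exists [set t | 0 <= t /\ `|0 - g t| <= e].
apply: ge_ereal_sup => _ [t [t0 gt] <-].
apply: (le_trans (fg t t0)); rewrite -EFinD lee_fin addrC lerD2l.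
by rewrite sub0r normrN in gt; exact: le_trans (ler_norm _) gt.
Qed.

End Slices.

Theorem theorem3p5 (R : realType) (d : nat) (hd : (0 < d)%N)
    (Sigma : 'M[R]_d) (kappa : R)
    (b_true b_model : torus R d -> probability (torus R d) R -> 'cV[R]_d)
    (K : R -> torus R d -> R) (h lambda : R) (T : \bar R)
    (mu nu : R -> density R d)
    (Bmodel Lmodel Lmu rhobar nulow : R) (delta : R -> R) (CP : R) :
  let A : 'M[R]_d := 2^-1 *: (Sigma *m Sigma^T) in
  let e (t : R) (x : torus R d) : R := nu t x - mu t x in
  let V (t : R) : \bar R := ((2^-1)%:E * (L2norm (e t)) ^+ 2)%E in
  let Ktilde : torus R d -> R := convolution (K h) (K h) in
  let Cadv : R := Bmodel + rhobar * Lmu in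
  let Delta : \bar R :=
    ereal_sup [set Linfty_norm_field (fun x : torus R d =>
                 b_model x (density_prob (mu t)) - b_true x (density_prob (mu t)))
              | t in horizon T] in
  let alpha : R := (kappa + lambda * nulow) / CP - 2 * Cadv ^+ 2 / kappa in
  forall (hA : positive_definite A)
    (hkappa : smallest_eigenvalue A kappa) (hkappa0 : 0 < kappa)
    (hK : forall h' : R, 0 < h' -> smoothing_kernel (K h'))
    (hh : 0 < h) (hlambda : 0 < lambda) (hT : (0 < T)%E)
    (hmu : fokker_planck_solution A b_true mu)
    (hnu : assimilated_solution A b_model (K h) lambda mu nu)
    (hinit : \int[haar]_x (nu 0 x - mu 0 x) = 0)
    (hBmodel : 0 < Bmodel) (hLmodel : 0 < Lmodel)
    (hbounded : bounded_drift b_model Bmodel)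
    (hlip : lipschitz_drift b_model Lmodel)
    (hlip2 : L2_lipschitz_drift b_model Lmu)
    (hupper : forall t, horizon T t ->
      (Linfty_norm (mu t) <= rhobar%:E)%E /\ (Linfty_norm (nu t) <= rhobar%:E)%E)
    (hnulow : 0 < nulow)
    (hlower : forall t x, horizon T t -> nulow <= nu t x)
    (hdelta : delta h' @[h' --> 0^'+] --> 0)
    (happrox : forall t, horizon T t -> 0 < t ->
      (L2norm_field (fun x => (grad (e t) x - grad (convolution Ktilde (e t)) x)%R) <=
        (delta h)%:E * L2norm_field (grad (e t)))%E)
    (hCP : poincare_constant d CP)
    (hdelta_small : delta h <= nulow / (2 * rhobar))
    (hlambda_large : nulow^-1 * (2 * Cadv ^+ 2 * CP / kappa - kappa) < lambda),
  [/\ 0 < alpha,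
      forall t, horizon T t ->
        (V t <= (expR (- alpha * t))%:E * V 0%R
                + (rhobar ^+ 2 / (alpha * kappa))%:E * Delta ^+ 2)%E &
      T = +oo%E ->
        (limf_esup (fun t => (L2norm (e t)) ^+ 2) (pinfty_nbhs R) <=
          (2 * rhobar ^+ 2 / (alpha * kappa))%:E * Delta ^+ 2)%E /\
        (Delta = 0%E -> ((L2norm (e t)) ^+ 2)%E @[t --> +oo%R] --> 0%E)].
Proof.
move=> A e V Ktilde Cadv Delta alpha hA hkappa kappa0 hK hh lambda0 hT hmu hnu _
  _ _ hbounded hlip hlip2 hupper nulow0 hlower _ happrox hCP hdelta hlambda.
have [cmu eqmu] := hmu; have [cnu eqnu] := hnu.
have [CP0 _] := hCP.
have T0 : horizon T 0 by split=> //; exact: ltW.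
have cmut t : 0 <= t -> continuous (mu t).
  exact: (continuous_slice (C12_cont cmu)).
have cnut t : 0 <= t -> continuous (nu t).
  exact: (continuous_slice (C12_cont cnu)).
have rho0 : 0 < rhobar.
  have [h0 _] := hupper 0 T0.
  exact: lt_le_trans (Linfty_norm_density_ge1 (cmut 0 (lexx 0)) h0).
(* This is the threshold on [lambda] multiplied by [nulow], then divided by [CP]. *)
have alpha0 : 0 < alpha.
  rewrite subr_gt0 ltr_pdivlMr//.
  have : nulow * (nulow^-1 * (2 * Cadv ^+ 2 * CP / kappa - kappa)) < nulow * lambda.
    by rewrite ltr_pM2l.
  rewrite mulVKf ?gt_eqF// => lamb.
  rewrite (_ : 2 * Cadv ^+ 2 / kappa * CP = 2 * Cadv ^+ 2 * CP / kappa); last by ring.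
  by rewrite [ltRHS]addrC -ltrBlDr (mulrC lambda).
have hsub s b : 0 <= s -> s <= b -> horizon T b -> horizon T s.
  move=> s0 sb [_ bT]; split=> //; apply: le_trans bT; by rewrite lee_fin.
pose E t := \int[haar]_x e t x ^+ 2.
have cet t : 0 <= t -> continuous (e t).
  by move=> t0 x; apply: continuousB; [exact: cnut|exact: cmut].
have L2e t : 0 <= t -> ((L2norm (e t)) ^+ 2 = (E t)%:E)%E.
  by move=> t0; rewrite (L2normE (cet t t0)) -EFin_expe L2n_sqr.
have E0 t : 0 <= E t by exact: Rintegral_sqr_ge0.
pose e' (t : R) (x : torus R d) :=
  time_deriv (fun t => nu t) t x - time_deriv (fun t => mu t) t x.
have ce : {within [set p : R * torus R d | 0 <= p.1],
    continuous (fun p : R * torus R d => e p.1 p.2)}.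
  move=> p; apply: (@continuousB _ _ (subspace [set p : R * torus R d | 0 <= p.1])
    (fun p => nu p.1 p.2) (fun p => mu p.1 p.2)).
    exact: (C12_cont cnu).
  exact: (C12_cont cmu).
have de (t : R) (x : torus R d) : 0 < t -> is_derive t (1 : R) (fun s => e s x) (e' t x).
  move=> t0.
  have dn := DeriveDef (C12_dt cnu (x := x) t0) (esym (derive1E _ _)).
  have dm := DeriveDef (C12_dt cmu (x := x) t0) (esym (derive1E _ _)).
  exact: is_deriveB.
have cde (p : R * torus R d) : 0 < p.1 ->
    {for p, continuous (fun p : R * torus R d => e' p.1 p.2)}.
  move=> p0; apply: (@continuousB _ _ _
    (fun p : R * torus R d => time_deriv (fun t => nu t) p.1 p.2)
    (fun p : R * torus R d => time_deriv (fun t => mu t) p.1 p.2)).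
    exact: (C12_dt_cont cnu).
  exact: (C12_dt_cont cmu).
(* Since [E] is twice [V], the source term in Gronwall is doubled. The bound is stated for a real
   [D], as [Delta] is an extended real. *)
have decay b D : 0 < b -> horizon T b ->
    (forall s, 0 < s < b -> (Linfty_norm_field (fun x =>
      (b_model x (density_prob (mu s)) - b_true x (density_prob (mu s)))%R) <= D%:E)%E) ->
    E b <= expR (- alpha * b) * E 0 + 2 * rhobar ^+ 2 / (alpha * kappa) * D ^+ 2.
  move=> b0 bT hD.
  have -> : 2 * rhobar ^+ 2 / (alpha * kappa) * D ^+ 2 =
      2 * (rhobar ^+ 2 * D ^+ 2 / kappa) / alpha by field; rewrite !gt_eqF.
  apply: gronwall => //.
  - apply: mulr_ge0 => //; apply: divr_ge0; last exact: ltW.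
    by apply: mulr_ge0; exact: sqr_ge0.
  - exact: continuous_energy.
  - move=> t /andP[t0 _].
    exact: (ex_derive (is_derive := is_derive_energy ce de cde t0)).
  move=> t /[dup] t0b /andP[t0 tb].
  rewrite derive1E (derive_val (is_derive := is_derive_energy ce de cde t0)).
  have tT := hsub t b (ltW t0) (ltW tb) bT.
  have [uup vup] := hupper t tT.
  have [C1Fm C1Nf dnu] := eqnu t t0; have [C1Ft dmu] := eqmu t t0.
  have C1u := C12_C1 cmu t0; have C1v := C12_C1 cnu t0.
  have := @energy_dissipation R d A kappa b_true b_model (K h) lambda (mu t) (nu t)
    Bmodel Lmodel Lmu rhobar nulow (delta h) CP D hA.1 hkappa kappa0 lambda0 (hK h hh)
    C1u C1v C1Ft C1Fm C1Nf (C1_diffusion_flux A cmu t0) (C1_diffusion_flux A cnu t0)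
    hbounded hlip hlip2 uup vup nulow0 (fun x => hlower t x tT) (happrox t tT t0)
    hCP hdelta (hD t t0b).
  rewrite (_ : (fun x => _) = fun x => e t x * e' t x); last first.
    by apply/funext => x; rewrite /e' dnu dmu.
  rewrite -/(E t) -/Cadv -/alpha => diss.
  have -> : - alpha * E t + 2 * (rhobar ^+ 2 * D ^+ 2 / kappa) =
    2 * (- (alpha / 2) * E t + rhobar ^+ 2 * D ^+ 2 / kappa) by field; rewrite gt_eqF.
  by rewrite ler_pM2l.
have Delta0 : (0 <= Delta)%E.
  apply: (@le_trans _ _ (Linfty_norm_field (fun x =>
    (b_model x (density_prob (mu 0)) - b_true x (density_prob (mu 0)))%R))).
    exact: Lnorm_ge0.
  by apply: ereal_sup_ubound; exists 0.
have hDelta s D : horizon T s -> Delta = D%:E -> (Linfty_norm_field (fun x =>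
    (b_model x (density_prob (mu s)) - b_true x (density_prob (mu s)))%R) <= D%:E)%E.
  by move=> sT <-; apply: ereal_sup_ubound; exists s.
have c20 : 0 < 2 * rhobar ^+ 2 / (alpha * kappa).
  by rewrite divr_gt0 ?mulr_gt0 ?exprn_gt0 ?mulr_gt0.
have decayT t D : horizon T t -> Delta = D%:E ->
    E t <= expR (- alpha * t) * E 0 + 2 * rhobar ^+ 2 / (alpha * kappa) * D ^+ 2.
  move=> /[dup] tT [t0 _] DD; move: t0; rewrite le_eqVlt => /predU1P[<-|t0].
    (* Time 0 is treated apart, because [decay] needs an interval of positive length. *)
    rewrite mulr0 expR0 mul1r lerDl; apply: mulr_ge0; last exact: sqr_ge0.
    exact: ltW.
  apply: decay => // s /andP[s0 st]; apply: hDelta => //.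
  exact: hsub (ltW s0) (ltW st) tT.
have c0 : 0 < rhobar ^+ 2 / (alpha * kappa) by rewrite divr_gt0 ?exprn_gt0 ?mulr_gt0.
(* If [Delta] is infinite, so is the right-hand side of each bound, its coefficient being
   positive. *)
have Dcase : Delta = +oo%E \/ exists D, Delta = D%:E.
  by case: (Delta) Delta0 => [D| |]//; [right; exists D|left].
have infty c : 0 < c -> (c%:E * (+oo) ^+ 2 = +oo :> \bar R)%E.
  by move=> cp; rewrite expe2 mulyy gt0_muley// lte_fin.
split=> // [t tT|Ty].
  have [t0 _] := tT; rewrite /V !L2e//.
  case: Dcase => [->|[D DD]].
    by rewrite infty// addey ?leey.
  rewrite DD -EFin_expe -!EFinM -EFinD lee_fin.
  have := decayT t D tT DD; set x := expR _ => dec.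
  have -> : x * (2^-1 * E 0) + rhobar ^+ 2 / (alpha * kappa) * D ^+ 2 =
    2^-1 * (x * E 0 + 2 * rhobar ^+ 2 / (alpha * kappa) * D ^+ 2).
    by field; rewrite !gt_eqF.
  by rewrite ler_pM2l.
have Thor t : 0 <= t -> horizon T t by move=> t0; split=> //; rewrite Ty leey.
split.
  case: Dcase => [->|[D DD]]; first by rewrite infty// leey.
  rewrite DD -EFin_expe -EFinM.
  apply: (@limf_esup_le_eventually _ _ (fun t => expR (- alpha * t) * E 0)).
    by move=> t t0; rewrite L2e// lee_fin; apply: decayT => //; exact: Thor.
  exact: expR_decay.
move=> D0.
have EE : E t @[t --> +oo] --> 0.
  apply: (@squeeze_cvgr _ _ _ _ (fun=> 0) (fun t => expR (- alpha * t) * E 0)).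
  - near=> t; rewrite E0/=.
    have := decayT t 0 (Thor t _) D0; rewrite expr0n mulr0 addr0; apply.
    by near: t; exact: nbhs_pinfty_ge.
  - exact: cvg_cst.
  - exact: expR_decay.
have EF : (E t)%:E @[t --> +oo%R] --> 0%:E.
  by apply: cvg_EFin; [exact: nearW|exact: EE].
apply: cvg_trans EF; apply: near_eq_cvg; near=> t.
rewrite L2e//; near: t; exact: nbhs_pinfty_ge.
Unshelve. all: by end_near. Qed.
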